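(* The function $\tau \mapsto h_\tau$ is continuous on $A_0$. Moreover, for each $\tau \in A_0$, $h_\tau$ is equal to the unique zero of the pressure function $P_\tau$ of $S_\tau$, one has $1 < h_\tau < 2$, and $h_\tau \to 1$ as $\tau \to \infty$ in $A_0$ (i.e. for each $\epsilon>0$ there is $N>0$ such that $|h_\tau - 1|<\epsilon$ for all $\tau\in A_0$ with $|\tau|\ge N$).
   Context: $\mathbb{N}$ denotes the set of positive integers. Let $A_0 := \{ \tau = u+iv \in \mathbb{C} : u \ge 0,\ v \ge 1\}$ and $X := \{ z \in \mathbb{C} : |z - 1/2| \le 1/2\}$. For $\tau \in A_0$ let $I_\tau := \{ m + n\tau : m,n \in \mathbb{N}\}$, and let $S_\tau := \{\phi_b : X \to X \mid b \in I_\tau\}$, where $\phi_b(z) := \frac{1}{z+b}$ for $z \in X$ (these maps do send $X$ into $X$ and are uniformly contracting). $\{S_\tau\}_{\tau\in A_0}$ is called the family of CIFSs (conformal iterated function systems) of generalized complex continued fractions. For a finite word $w = w_1\cdots w_n \in I_\tau^n$ put $\phi_w := \phi_{w_1}\circ\cdots\circ\phi_{w_n}$. For an infinite word $w = w_1w_2\cdots \in I_\tau^{\mathbb{N}}$ put $w|_n := w_1\cdots w_n$; the set $\bigcap_{n\in\mathbb{N}} \phi_{w|_n}(X)$ is a singleton. The limit set of $S_\tau$ is $J_\tau := \bigcup_{w \in I_\tau^{\mathbb{N}}} \bigcap_{n\in\mathbb{N}} \phi_{w|_n}(X)$, and $h_\tau := \dim_{\mathcal{H}} J_\tau$ is its Hausdorff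 dimension (with respect to the Euclidean metric). For $t \ge 0$ and $n\in\mathbb{N}$ let $\psi_\tau^n(t) := \sum_{w \in I_\tau^n} \left(\sup_{z\in X} |\phi_w'(z)|\right)^t \in [0,\infty]$. The pressure function $P_\tau : [0,\infty) \to (-\infty,\infty]$ of $S_\tau$ is $P_\tau(t) := \lim_{n\to\infty} \frac1n \log \psi_\tau^n(t)$ (the limit exists by subadditivity). *)

(* Defs.v *)
From HB Require Import structures.
From mathcomp Require Import all_boot all_order all_algebra.
From mathcomp Require Import complex.
From mathcomp Require Import all_classical all_reals all_analysis.

Set Implicit Arguments.
Unset Strict Implicit.
Unset Printing Implicit Defensive.

Import Order.TTheory GRing.Theory Num.Theory numFieldNormedType.Exports.

Local Open Scope classical_set_scope.
Local Open Scope ring_scope.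

(* The library equips the sort of any [numFieldType] with the topology of its
   norm; here the same is done for [R[i]], as a normed space over itself. *)
#[non_forgetful_inheritance]
HB.instance Definition _ (R : realType) := NormedModule.copy R[i] R[i]^o.

(* The norm [`|z|] of [z : R[i]] has type [R[i]]; [cmod z] is the same number
   as an element of [R]. *)
Definition cmod (R : realType) (z : R[i]) : R := complex.Re `|z|.

Section hausdorff_dimension.
Context {R : realType}.
Implicit Types (A U : set R[i]) (s delta : R).
Local Open Scope ereal_scope.

(* 0 is adjoined so that the empty set has diameter 0 (and not -oo). *)
Definition diam U : \bar R :=
  ereal_sup (0 |` [set (cmod (x - y))%:E | x in U & y in U]).

(* diam(U)^s, with the convention 0^0 = 1 for nonempty U; the empty set
   contributes 0, also when s = 0. *)
Definition hausdorff_gauge s U : \bar R :=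
  if U == set0 then 0 else diam U `^ s.

Definition hausdorff_premeasure s delta A : \bar R :=
  ereal_inf [set \sum_(0 <= k <oo) hausdorff_gauge s (U k) |
    U in [set U : (set R[i])^nat |
      A `<=` \bigcup_k U k /\ forall k, diam (U k) <= delta%:E]].

Definition hausdorff_measure s A : \bar R :=
  ereal_sup [set hausdorff_premeasure s delta A |
    delta in [set delta : R | (0 < delta)%R]].

Definition hausdorff_dim A : \bar R :=
  ereal_inf [set s%:E | s in [set s : R |
    (0 <= s)%R /\ hausdorff_measure s A = 0]].

End hausdorff_dimension.

Section complex_continued_fractions.
Context {R : realType}.
Implicit Types (tau b z : R[i]) (t : R).

Definition A0 : set R[i] :=
  [set tau | 0 <= complex.Re tau /\ 1 <= complex.Im tau].

Definition X : set R[i] := [set z | cmod (z - 2^-1) <= 2^-1].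

Definition alphabet tau : set R[i] :=
  [set b | exists m n : nat,
    [/\ (0 < m)%N, (0 < n)%N & b = m%:R + n%:R * tau]].

(* A total function on the complex plane. For b in [alphabet tau] with tau in
   [A0] it is holomorphic near [X] and maps [X] into itself, so the complex
   derivative at a point of [X] is the usual one, also at the boundary. *)
Definition phi b : R[i] -> R[i] := fun z => (z + b)^-1.

(* [phi_word [:: w1; ...; wn]] is [phi w1 \o ... \o phi wn]. *)
Definition phi_word (w : seq R[i]) : R[i] -> R[i] :=
  foldr (fun b f => phi b \o f) id w.

Definition words tau (n : nat) : set (n.-tuple R[i]) :=
  [set w | forall i, alphabet tau (tnth w i)].
Arguments words tau n : clear implicits.

(* [mkseq w n] is the prefix [:: w 0; ...; w (n-1)], the first n letters. *)
Definition limit_set tau : set R[i] :=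
  \bigcup_(w in [set w : nat -> R[i] | forall k, alphabet tau (w k)])
    \bigcap_(n in [set n | (0 < n)%N]) (phi_word (mkseq w n) @` X).

(* Only meaningful when the dimension is finite, as [fine] sends +oo to 0. *)
Definition h tau : R := fine (hausdorff_dim (limit_set tau)).

Definition deriv_norm (w : seq R[i]) : \bar R :=
  ereal_sup [set (cmod (derive1 (phi_word w) z))%:E | z in X].

Definition psi tau (n : nat) t : \bar R :=
  (\esum_(w in words tau n) deriv_norm w `^ t)%E.

Definition pressure tau t : \bar R :=
  limn (fun n => (n%:R^-1)%:E * lne (psi tau n t))%E.

End complex_continued_fractions.

(* Main.v *)
Require Import Defs.
From HB Require Import structures.
From mathcomp Require Import all_boot all_order all_algebra.
From mathcomp Require Import complex.
From mathcomp Require Import all_classical all_reals all_analysis.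
From mathcomp Require Import ring lra zify.
Import Order.TTheory GRing.Theory Num.Theory numFieldNormedType.Exports.
Local Open Scope classical_set_scope.
Local Open Scope ring_scope.

Set Implicit Arguments.
Unset Strict Implicit.
Unset Printing Implicit Defensive.

(** The proof rests on two facts. First, a word of Möbius maps satisfies the exact
    identity phi_w x - phi_w y = (x - y) d_w(x) d_w(y), where d_w is a holomorphic square
    root of the derivative of phi_w ([phi_word_sub]), and d_w has a single pole, which lies
    in the half-plane Re <= -1; so the modulus of d_w varies at most by a factor 2 on the
    disk ([root_deriv_distortion]). Hence the supremum ||w|| of |phi_w'| is, up to a factor
    4, the contraction ratio of phi_w between any two points, and it is multiplicative up to
    a factor 4 under concatenation. Second, the generators map the disk into a part of it
    whose translates by distinct letters are uniformly separated ([letter_separated]), so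
    that the images of this part under finitely many words of the same length are at
    positive distance ([words_separated]).

    Let Z_n(t) be the sum of ||w||^t over the words of length n ([psum]). The Hausdorff
    dimension h is controlled by these sums alone. If Z_n(s) < 1 for some n > 0, the covers
    by the images of the words of length k n show that the measure of exponent s vanishes
    ([hausdorff_measure_null]). If Z_n(s) > 4^s for some n, finitely many words of length n
    with ratios ||w||/4 form a separated system with sum of the s-th powers of the ratios at
    least 1, and a pigeonhole argument along its tree bounds every cover from below
    ([cover_lower_bound], [hausdorff_measure_pos]). Both conditions are
    stable under small changes of s, so that Z_n(s) > 4^s implies s < h ([lt_h]), and
    Z_n(s) < 1 implies h < s if s > 1 ([h_lt_psum]). Consequently 1 <= Z_n(h) <= 4^h for all n > 0.

    Everything else is read off. The pressure vanishes at h by the last inequalities. At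
    any t > 1 it is a limit of real numbers by almost additivity, and it is nonzero if t is
    not h, since ||w|| <= (2/3)^n for the words of length n ([psum_shift]); at t <= 1 it is
    infinite. From Z_1(1) = oo follows h > 1; from Z_1(2) < 1, an estimate of a sum of
    |b + z|^(-4) over the quadrant, follows h < 2. For t > 1 the sum Z_1(t) is at most
    |tau|^(-t) zeta(t)^2, which is less than 1 for |tau| large; hence h tends to 1. Finally,
    changing tau to tau' multiplies each ||w|| of length n by at most
    (1 + 8 |tau - tau'|)^(2n) ([norm_word_perturb]), so h is continuous, uniformly
    on [A0]. *)

Local Notation Re := complex.Re.
Local Notation Im := complex.Im.

(** * The modulus on the complex plane *)

Section modulus.
Context {R : realType}.
Implicit Types x y z : R[i].

Lemma ReD x y : Re (x + y) = Re x + Re y. Proof. by case: x y => [? ?] []. Qed.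
Lemma ImD x y : Im (x + y) = Im x + Im y. Proof. by case: x y => [? ?] []. Qed.
Lemma ReN x : Re (- x) = - Re x. Proof. by case: x. Qed.
Lemma ImN x : Im (- x) = - Im x. Proof. by case: x. Qed.
Lemma ReB x y : Re (x - y) = Re x - Re y. Proof. by rewrite ReD ReN. Qed.
Lemma ImB x y : Im (x - y) = Im x - Im y. Proof. by rewrite ImD ImN. Qed.
Lemma Re_nat n : Re (n%:R : R[i]) = n%:R.
Proof. by elim: n => // n IH; rewrite -addn1 !natrD ReD IH. Qed.
Lemma Im_nat n : Im (n%:R : R[i]) = 0.
Proof. by elim: n => // n IH; rewrite -addn1 natrD ImD IH addr0. Qed.
Lemma Re_natM n x : Re (n%:R * x) = n%:R * Re x.
Proof. by rewrite !mulr_natl; elim: n => [|n IH]; rewrite ?mulr0n// !mulrS ReD IH. Qed.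
Lemma Im_natM n x : Im (n%:R * x) = n%:R * Im x.
Proof. by rewrite !mulr_natl; elim: n => [|n IH]; rewrite ?mulr0n// !mulrS ImD IH. Qed.
Lemma ReV x : Re x^-1 = Re x / (Re x ^+ 2 + Im x ^+ 2).
Proof. by case: x. Qed.
Lemma ImV x : Im x^-1 = - Im x / (Re x ^+ 2 + Im x ^+ 2).
Proof. by case: x => a b /=; rewrite mulNr. Qed.
Lemma Re_half : Re (2^-1 : R[i]) = 2^-1.
Proof. by rewrite ReV Re_nat Im_nat; field. Qed.
Lemma Im_half : Im (2^-1 : R[i]) = 0.
Proof. by rewrite ImV Im_nat oppr0 mul0r. Qed.

Lemma normc_cmod z : `|z| = (cmod z)%:C%C.
Proof. by rewrite /cmod normc_def. Qed.

Lemma cmodE z : cmod z = Num.sqrt (Re z ^+ 2 + Im z ^+ 2).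
Proof. by rewrite /cmod normc_def. Qed.

Lemma cmod_sqr z : cmod z ^+ 2 = Re z ^+ 2 + Im z ^+ 2.
Proof. by rewrite cmodE sqr_sqrtr// addr_ge0// sqr_ge0. Qed.

Lemma cmod_ge0 z : 0 <= cmod z. Proof. by rewrite cmodE sqrtr_ge0. Qed.

Lemma cmodM x y : cmod (x * y) = cmod x * cmod y.
Proof. by apply: complexI; rewrite rmorphM/= -!normc_cmod normrM. Qed.

Lemma cmodV x : cmod x^-1 = (cmod x)^-1.
Proof. by apply: complexI; rewrite fmorphV/= -!normc_cmod normfV. Qed.

Lemma cmodN x : cmod (- x) = cmod x. Proof. by rewrite /cmod normrN. Qed.

Lemma cmod_distC x y : cmod (x - y) = cmod (y - x).
Proof. by rewrite -cmodN opprB. Qed.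

Lemma cmod0 : cmod (0 : R[i]) = 0. Proof. by rewrite /cmod normr0. Qed.
Lemma cmod1 : cmod (1 : R[i]) = 1. Proof. by rewrite /cmod normr1. Qed.

Lemma cmod_triangle x y : cmod (x + y) <= cmod x + cmod y.
Proof.
rewrite -lecR rmorphD/= -!normc_cmod; exact: ler_normD.
Qed.

Lemma cmod_dist_triangle z x y : cmod (x - y) <= cmod (x - z) + cmod (z - y).
Proof. by rewrite -[x - y](subrKA z) cmod_triangle. Qed.

Lemma cmod_sub_triangle x y : cmod x <= cmod y + cmod (x - y).
Proof. by have := cmod_triangle y (x - y); rewrite addrC subrK. Qed.

Lemma ler_cmod z (r : R) : 0 <= r -> (cmod z <= r) = (Re z ^+ 2 + Im z ^+ 2 <= r ^+ 2).
Proof. by move=> r0; rewrite -cmod_sqr ler_sqr// nnegrE ?cmod_ge0. Qed.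

Lemma cmod_ger z (r : R) : 0 <= r -> (r <= cmod z) = (r ^+ 2 <= Re z ^+ 2 + Im z ^+ 2).
Proof. by move=> r0; rewrite -cmod_sqr ler_sqr// nnegrE ?cmod_ge0. Qed.

Lemma Re_cmod z : `|Re z| <= cmod z.
Proof. by rewrite cmod_ger// real_normK ?num_real// lerDl sqr_ge0. Qed.

Lemma Im_cmod z : `|Im z| <= cmod z.
Proof. by rewrite cmod_ger// real_normK ?num_real// lerDr sqr_ge0. Qed.

Lemma cmod_le_ReIm z : cmod z <= `|Re z| + `|Im z|.
Proof.
rewrite ler_cmod ?addr_ge0// sqrrD !real_normK ?num_real//.
by rewrite -addrA lerD2l lerDr mulrn_wge0// mulr_ge0.
Qed.

Lemma cmod_eq0 z : (cmod z == 0) = (z == 0).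
Proof.
by rewrite -[RHS]normr_eq0 normc_cmod -(rmorph0 (real_complex R)) (inj_eq (@complexI _)).
Qed.

Lemma cmod_gt0 z : (0 < cmod z) = (z != 0).
Proof. by rewrite lt_def cmod_ge0 andbT cmod_eq0. Qed.

End modulus.

(** * Möbius maps and their words *)

Section moebius.
Context {R : realType}.
Implicit Types (x y z b : R[i]) (u v w : seq R[i]).

Definition good b := (1 <= Re b) && (1 <= Im b).

Lemma X_ReIm z : X z <-> Re z ^+ 2 + Im z ^+ 2 <= Re z.
Proof.
rewrite /X/= ler_cmod ?invr_ge0//= ReB ImB Re_half Im_half subr0.
have -> : (2^-1 : R) ^+ 2 = 4^-1 by field.
by split => ?; lra.
Qed.

Lemma X_Re_ge0 z : X z -> 0 <= Re z.
Proof. by move=> /X_ReIm; apply: le_trans; rewrite addr_ge0 ?sqr_ge0. Qed.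

Lemma X_Im_ge z : X z -> - 2^-1 <= Im z.
Proof. by move=> /X_ReIm; have := sqr_ge0 (Im z); have := sqr_ge0 (Re z - 2^-1); nra. Qed.

Lemma X_ReIm_sum z : X z -> - 4^-1 <= Re z + Im z.
Proof. by move=> /X_ReIm; have := sqr_ge0 (Re z - 2^-1 - Im z); nra. Qed.

Lemma X_diam x y : X x -> X y -> cmod (x - y) <= 1.
Proof.
move=> Xx Xy; apply: le_trans (cmod_dist_triangle 2^-1 x y) _.
rewrite [cmod (2^-1 - y)]cmod_distC.
by move: Xx Xy; rewrite /X/= => Xx Xy; lra.
Qed.

Lemma X0 : X (0 : R[i]).
Proof. by apply/X_ReIm; rewrite /= expr0n addr0. Qed.

Lemma goodD_neq0 z b : good b -> -1 < Re z -> z + b != 0.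
Proof.
move=> /andP[b1 _] z1; apply/eqP => zb.
have : Re (z + b) = 0 by rewrite zb.
by rewrite ReD; lra.
Qed.

(** Thus the half-plane Re > -1, a neighbourhood of [X], contains no pole of any word. *)
Lemma Re_phi_gt0 z b : good b -> -1 < Re z -> 0 < Re (phi b z).
Proof.
move=> gb z1; have zb0 := goodD_neq0 gb z1.
have : 0 < cmod (z + b) ^+ 2 by rewrite exprn_gt0// cmod_gt0.
rewrite /phi ReV cmod_sqr => den0; rewrite divr_gt0// ReD.
by move: gb => /andP[b1 _]; lra.
Qed.

Lemma phi_sub b x y : x + b != 0 -> y + b != 0 ->
  phi b x - phi b y = (y - x) / ((x + b) * (y + b)).
Proof. by move=> xb yb; rewrite /phi; field; rewrite xb yb. Qed.

(** The distance of [z + b] to the origin is at least its distance to the antidiagonal;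
    on [X] the sum of the coordinates is at least (1 - sqrt 2) / 2 > -1/4. *)
Lemma cmod_den_ge z b : X z -> 0 <= Re b + Im b - 4^-1 ->
  (Re b + Im b - 4^-1) ^+ 2 / 2 <= cmod (z + b) ^+ 2.
Proof.
move=> /X_ReIm_sum z4 b0; rewrite cmod_sqr ReD ImD.
have : (Re b + Im b - 4^-1) ^+ 2 <= (Re z + Re b + (Im z + Im b)) ^+ 2.
  by rewrite ler_sqr ?nnegrE; lra.
have := sqr_ge0 (Re z + Re b - (Im z + Im b)); lra.
Qed.

Lemma good_den z b : good b -> X z -> 3 / 2 <= cmod (z + b) ^+ 2.
Proof.
move=> /andP[b1 b2] Xz; apply: le_trans (cmod_den_ge Xz _); nra.
Qed.

Lemma good_den1 z b : good b -> X z -> 1 <= cmod (z + b).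
Proof. by move=> gb Xz; have := good_den gb Xz; have := cmod_ge0 (z + b); nra. Qed.

Lemma X_ReN1 z : X z -> -1 < Re z. Proof. by move=> /X_Re_ge0; lra. Qed.

Lemma phi_X b z : good b -> X z -> X (phi b z).
Proof.
move=> gb Xz; have /X_ReN1 z1 := Xz.
apply/X_ReIm; rewrite -cmod_sqr cmodV exprVn /phi ReV -cmod_sqr.
rewrite -[X in X <= _]mul1r ler_wpM2r// ?invr_ge0 ?sqr_ge0// ReD.
by move: gb Xz => /andP[b1 _] /X_Re_ge0; lra.
Qed.

(** The square of the modulus is at most 2/3, so that the images of the generators stay
    away from the point 1, at which [X] touches its translate by 1. *)
Lemma phi_Re_le b z : good b -> X z -> Re (phi b z) <= 5 / 6.
Proof.
move=> gb Xz; apply: le_trans (ler_norm _) _; apply: le_trans (Re_cmod _) _.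
rewrite /phi cmodV.
have zb0 : 0 < cmod (z + b) by apply: lt_le_trans (good_den1 gb Xz).
rewrite -[_^-1]mul1r ler_pdivrMr//.
by have := good_den gb Xz; nra.
Qed.

Lemma phi_Im_le0 b z : good b -> X z -> Im (phi b z) <= 0.
Proof.
move=> gb Xz; rewrite /phi ImV mulNr oppr_le0 divr_ge0 ?addr_ge0 ?sqr_ge0//.
by rewrite ImD; move: gb Xz => /andP[_ b1] /X_Im_ge; lra.
Qed.

Lemma phi_word_cat u v z : phi_word (u ++ v) z = phi_word u (phi_word v z).
Proof. by elim: u => //= b u IH; rewrite IH. Qed.

Lemma phi_word_ReN1 w z : all good w -> -1 < Re z -> -1 < Re (phi_word w z).
Proof.
elim: w => //= b w IH /andP[gb gw] z1.
by apply: lt_trans (Re_phi_gt0 gb (IH gw z1)); rewrite ltrN10.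
Qed.

Lemma phi_word_X w z : all good w -> X z -> X (phi_word w z).
Proof. by elim: w => //= b w IH /andP[gb gw] Xz; apply: phi_X (IH _ _). Qed.

(** A holomorphic square root of the derivative of [phi_word w], which
    exists as the maps are Möbius; the factor 'i absorbs the sign of the derivative
    of the inversion. *)
Fixpoint root_deriv w z : R[i] :=
  if w is b :: v then 'i%C / (phi_word v z + b) * root_deriv v z else 1.

Lemma root_deriv_cat u v z :
  root_deriv (u ++ v) z = root_deriv u (phi_word v z) * root_deriv v z.
Proof.
by elim: u => [|b u IH] /=; rewrite ?mul1r// IH phi_word_cat mulrA.
Qed.

(** For a single inversion this is 1/x - 1/y = - (x - y) / (x y). *)
Lemma phi_word_sub w x y : all good w -> -1 < Re x -> -1 < Re y ->
  phi_word w x - phi_word w y = (x - y) * (root_deriv w x * root_deriv w y).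
Proof.
move=> + x1 y1; elim: w => [_|b w IH /= /andP[gb gw]]; first by rewrite /= !mulr1.
have xb : phi_word w x + b != 0 by apply: goodD_neq0 => //; apply: phi_word_ReN1.
have yb : phi_word w y + b != 0 by apply: goodD_neq0 => //; apply: phi_word_ReN1.
rewrite phi_sub// -[_ - phi_word w x]opprB IH// mulNr.
rewrite [RHS](_ : _ = 'i%C ^+ 2 *
  ((x - y) * (root_deriv w x * root_deriv w y)
   / ((phi_word w x + b) * (phi_word w y + b)))).
  by rewrite sqr_i mulN1r.
by field; rewrite xb yb.
Qed.

(** The derivative of a nonempty word has a single pole, and the recursion
    rho -> b + 1/rho, for the opposite of the pole, keeps Re rho >= 1. *)
Lemma root_deriv_pole w : all good w -> w != [::] ->
  exists k rho : R[i], 1 <= Re rho /\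
    forall z, -1 < Re z -> root_deriv w z = k / (z + rho).
Proof.
elim/last_ind: w => // w b IH; rewrite all_rcons => /andP[gb gw] _.
have [->/=|w0] := eqVneq w [::].
  by exists 'i%C, b; split => [|z _]; [case/andP: gb | rewrite mulr1].
have [k [rho [rho1 kP]]] := IH gw w0.
have rho0 : rho != 0 by apply/eqP => r0; move: rho1; rewrite r0 /= ler10.
have den0 : 0 < cmod rho ^+ 2 by rewrite exprn_gt0// cmod_gt0.
have Rerho : 0 < Re rho^-1.
  by rewrite ReV -cmod_sqr divr_gt0//; lra.
exists ('i%C * k / rho), (b + rho^-1); split=> [|z z1].
  by rewrite ReD; case/andP: gb => b1 _; lra.
rewrite -cats1 root_deriv_cat /= mulr1 kP; last first.
  by apply: lt_trans (Re_phi_gt0 gb z1); rewrite ltrN10.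
have zb := goodD_neq0 gb z1.
have zr : (z + b) * rho + 1 != 0.
  rewrite -(mulVf rho0) -mulrDl mulf_neq0//.
  apply/eqP => /(congr1 (@complex.Re R)); rewrite /= !ReD.
  by case/andP: gb => b1 _; lra.
rewrite /phi /=; field; rewrite zb rho0 /=; apply/andP; split => //.
by apply: contra_neq zr => <-; ring.
Qed.

Lemma root_deriv_neq0 w z : all good w -> -1 < Re z -> root_deriv w z != 0.
Proof.
move=> + z1; elim: w => [|b w IH] /=; first by rewrite oner_neq0.
move=> /andP[gb gw]; rewrite !mulf_neq0 ?IH//.
  by rewrite eq_complex/= oner_eq0 andbF.
by rewrite invr_eq0 goodD_neq0// phi_word_ReN1.
Qed.

(** The ratio is that of the distances of [x] and [y] to the pole. *)
Lemma root_deriv_distortion w x y : all good w -> X x -> X y ->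
  cmod (root_deriv w x) <= 2 * cmod (root_deriv w y).
Proof.
move=> gw Xx Xy; have [->/=|w0] := eqVneq w [::].
  by rewrite cmod1; lra.
have [k [rho [rho1 kP]]] := root_deriv_pole gw w0.
rewrite !kP ?X_ReN1// !cmodM !cmodV mulrCA ler_wpM2l ?cmod_ge0//.
have ge1 z : X z -> 1 <= cmod (z + rho).
  move=> /X_Re_ge0 z0; apply: le_trans (Re_cmod _).
  by apply: le_trans (ler_norm _); rewrite ReD; lra.
have x1 := ge1 _ Xx; have y1 := ge1 _ Xy.
rewrite ler_pdivlMr; last lra.
rewrite mulrC ler_pdivrMr; last lra.
have := cmod_sub_triangle (y + rho) (x + rho).
have -> : y + rho - (x + rho) = y - x by ring.
by have := X_diam Xy Xx; lra.
Qed.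

Lemma cmodi : cmod ('i%C : R[i]) = 1.
Proof. by rewrite cmodE /= expr0n expr1n add0r sqrtr1. Qed.

Lemma root_deriv_le w z : all good w -> X z ->
  cmod (root_deriv w z) ^+ 2 <= (2 / 3) ^+ size w.
Proof.
move=> + Xz; elim: w => [|b w IH] /=; first by rewrite cmod1 expr1n.
move=> /andP[gb gw]; rewrite !cmodM cmodi mul1r exprMn [leRHS]exprS.
apply: ler_pM => //; rewrite ?sqr_ge0// ?IH// cmodV exprVn.
have := good_den gb (phi_word_X gw Xz) => d.
by rewrite -[2 / 3]invf_div lef_pV2// posrE; lra.
Qed.

(** The supremum over [X] of the modulus of the derivative of [phi_word w]. *)
Definition norm_deriv w : R := sup [set cmod (root_deriv w z) ^+ 2 | z in X].

Lemma norm_deriv_has_sup w : all good w ->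
  has_sup [set cmod (root_deriv w z) ^+ 2 | z in X].
Proof.
move=> gw; split; first by exists (cmod (root_deriv w 0) ^+ 2), 0 => //; exact: X0.
by exists ((2 / 3) ^+ size w) => _ [z Xz <-]; apply: root_deriv_le.
Qed.

Lemma le_norm_deriv w z : all good w -> X z ->
  cmod (root_deriv w z) ^+ 2 <= norm_deriv w.
Proof.
move=> gw Xz; apply: ub_le_sup; last by exists z.
by case: (norm_deriv_has_sup gw).
Qed.

Lemma norm_deriv_le w (r : R) : all good w ->
  (forall z, X z -> cmod (root_deriv w z) ^+ 2 <= r) -> norm_deriv w <= r.
Proof.
move=> gw wr; apply: ge_sup; first by case: (norm_deriv_has_sup gw).
by move=> _ [z Xz <-]; apply: wr.
Qed.

Lemma norm_deriv_gt0 w : all good w -> 0 < norm_deriv w.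
Proof.
move=> gw; apply: lt_le_trans (le_norm_deriv gw X0).
by rewrite exprn_gt0// cmod_gt0 root_deriv_neq0// (X_ReN1 X0).
Qed.

Lemma norm_deriv_size w : all good w -> norm_deriv w <= (2 / 3) ^+ size w.
Proof. by move=> gw; apply: norm_deriv_le => // z; apply: root_deriv_le. Qed.

Lemma norm_deriv_le1 w : all good w -> norm_deriv w <= 1.
Proof.
move=> gw; apply: le_trans (norm_deriv_size gw) _; rewrite exprn_ile1 ?divr_ge0//.
by rewrite ler_pdivrMr// mul1r ler_nat.
Qed.

Lemma norm_deriv_distortion w z : all good w -> X z ->
  norm_deriv w <= 4 * cmod (root_deriv w z) ^+ 2.
Proof.
move=> gw Xz; apply: norm_deriv_le => // y Xy.
have := root_deriv_distortion gw Xy Xz; have := cmod_ge0 (root_deriv w y); nra.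
Qed.

Lemma norm_deriv_cat_le u v : all good u -> all good v ->
  norm_deriv (u ++ v) <= norm_deriv u * norm_deriv v.
Proof.
move=> gu gv; apply: norm_deriv_le => [|z Xz]; first by rewrite all_cat gu.
rewrite root_deriv_cat cmodM exprMn ler_pM ?sqr_ge0 ?le_norm_deriv//.
exact: phi_word_X.
Qed.

Lemma norm_deriv_cat_ge u v : all good u -> all good v ->
  norm_deriv u * norm_deriv v <= 4 * norm_deriv (u ++ v).
Proof.
move=> gu gv; have u0 := norm_deriv_gt0 gu.
have guv : all good (u ++ v) by rewrite all_cat gu.
rewrite mulrC -ler_pdivlMr//; apply: norm_deriv_le => // z Xz.
have := norm_deriv_distortion gu (phi_word_X gv Xz).
have := le_norm_deriv guv Xz; have := sqr_ge0 (cmod (root_deriv v z)).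
rewrite ler_pdivlMr// root_deriv_cat cmodM exprMn; nra.
Qed.

Lemma phi_word_contract w x y : all good w -> X x -> X y ->
  cmod (phi_word w x - phi_word w y) <= norm_deriv w * cmod (x - y).
Proof.
move=> gw Xx Xy; rewrite phi_word_sub ?X_ReN1// cmodM [leRHS]mulrC.
rewrite ler_wpM2l ?cmod_ge0// cmodM.
have := le_norm_deriv gw Xx; have := le_norm_deriv gw Xy; nra.
Qed.

Lemma phi_word_expand w x y : all good w -> X x -> X y ->
  norm_deriv w / 4 * cmod (x - y) <= cmod (phi_word w x - phi_word w y).
Proof.
move=> gw Xx Xy; rewrite phi_word_sub ?X_ReN1// cmodM mulrC.
rewrite ler_wpM2l ?cmod_ge0// cmodM.
have x4 := norm_deriv_distortion gw Xx; have y4 := norm_deriv_distortion gw Xy.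
rewrite -ler_sqr ?nnegrE; last 2 first.
- by rewrite divr_ge0// ltW// norm_deriv_gt0.
- by rewrite mulr_ge0 ?cmod_ge0.
have n0 := norm_deriv_gt0 gw; rewrite [leRHS]exprMn [leLHS]expr2 ler_pM//; lra.
Qed.

End moebius.

Section derivative.
Context {R : realType}.
Implicit Types (x y z b : R[i]) (u v w : seq R[i]).

(** The pole of [root_deriv w], if there is one, is at distance at least 1/2 of [x]. *)
Lemma root_deriv_lipschitz w z x : all good w -> X z -> cmod (x - z) <= 2^-1 ->
  -1 < Re x ->
  cmod (root_deriv w x - root_deriv w z) <= 2 * cmod (root_deriv w z) * cmod (x - z).
Proof.
move=> gw Xz xz x1; have [->/=|w0] := eqVneq w [::].
  by rewrite subrr cmod0 mulr_ge0 ?mulr_ge0 ?cmod_ge0.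
have [k [rho [rho1 kP]]] := root_deriv_pole gw w0.
have z0 := X_Re_ge0 Xz.
have Rz : 1 <= Re (z + rho) by rewrite ReD; lra.
have Rx : 2^-1 <= Re (x + rho).
  rewrite ReD; have := le_trans (Re_cmod (x - z)) xz.
  by rewrite ReB ler_norml => /andP[]; lra.
have nz y r : 0 < r -> r <= Re y -> y != 0.
  by move=> r0; apply: contraTneq => ->; rewrite -ltNge.
have zr : z + rho != 0 by apply: nz Rz.
have xr : x + rho != 0 by apply: nz Rx; rewrite invr_gt0.
have -> : root_deriv w x - root_deriv w z = root_deriv w z * (z - x) / (x + rho).
  rewrite (kP x x1) (kP z (X_ReN1 Xz)).
  by field; rewrite zr xr.
have xr2 : 2^-1 <= cmod (x + rho).
  by apply: le_trans (Re_cmod _); apply: le_trans (ler_norm _).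
have xr3 : (cmod (x + rho))^-1 <= 2 by rewrite invf_ple ?posrE ?cmod_gt0.
rewrite 2!cmodM cmodV [cmod (z - x)]cmod_distC [leLHS]mulrC mulrA.
by rewrite !ler_wpM2r ?cmod_ge0.
Qed.

Lemma derive1_phi_word w z : all good w -> X z ->
  derive1 (phi_word w) z = root_deriv w z ^+ 2.
Proof.
move=> gw Xz; rewrite /derive1; apply/cvg_lim => //.
apply/cvgrPdist_lt => /= e e0.
have [ep ep0 eE] : exists2 ep : R, 0 < ep & e = ep%:C%C.
  exists (Re e); last by rewrite RRe_real// gtr0_real.
  by move: e0; rewrite ltcE => /andP[].
near=> h.
have h0 : h != 0 by near: h; exact: nbhs_dnbhs_neq.
have hs : cmod h < Num.min 2^-1 (ep / 2).
  rewrite -ltcR -normc_cmod; near: h; apply: dnbhs0_lt.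
  by rewrite ltcE /= eqxx lt_min divr_gt0 ?invr_gt0 ?ltr0n.
move: hs; rewrite lt_min => /andP[h2 he].
have hz : -1 < Re (h + z).
  have := le_lt_trans (Re_cmod h) h2; rewrite ReD ltr_norml => /andP[+ _].
  by have := X_Re_ge0 Xz; lra.
rewrite (phi_word_sub gw hz (X_ReN1 Xz)) addrK -[_ *: _]/(h^-1 * (h * _)) mulKf//.
rewrite distrC expr2 -mulrBl normrM !normc_cmod -rmorphM/= eE ltcR.
have hzh : h + z - z = h by rewrite addrK.
have := root_deriv_lipschitz gw Xz _ hz; rewrite hzh => /(_ (ltW h2)) dl.
have r1 : cmod (root_deriv w z) <= 1.
  rewrite -(@expr_le1 _ 2) ?cmod_ge0//.
  exact: le_trans (le_norm_deriv gw Xz) (norm_deriv_le1 gw).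
have := cmod_ge0 (root_deriv w z); have := cmod_ge0 h.
set r := cmod (root_deriv w z) in dl r1 *; set d := cmod (_ - _) in dl *.
move=> hh rr; apply: le_lt_trans (_ : 2 * cmod h < _); last by lra.
apply: le_trans (ler_piMr _ r1) _; first exact: cmod_ge0.
by apply: le_trans dl _; rewrite -mulrA ler_wpM2l// ler_piMl.
Unshelve. all: by end_near. Qed.

Lemma deriv_normE w : all good w -> deriv_norm w = (norm_deriv w)%:E.
Proof.
move=> gw; have [S0 Sub] := norm_deriv_has_sup gw.
rewrite /deriv_norm /norm_deriv -ereal_sup_EFin//.
congr ereal_sup; rewrite image_comp; apply: eq_imagel => z Xz /=.
by rewrite derive1_phi_word// cmodM.
Qed.

End derivative.

(** * Sums of nonnegative families *)

Section esum_extra.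
Context {R : realType}.
Local Open Scope ereal_scope.

Lemma esumZl_le (T : choiceType) (I : set T) (c : \bar R) (a : T -> \bar R) :
  0 <= c -> (forall i, 0 <= a i) ->
  \esum_(i in I) (c * a i) <= c * \esum_(i in I) a i.
Proof.
move=> c0 a0; apply: ge_ereal_sup => _ [X XI <-].
rewrite -ge0_mule_fsumr// lee_wpmul2l//; apply: ereal_sup_ubound.
by exists X.
Qed.

Lemma le_esum_term (T : choiceType) (I : set T) (a : T -> \bar R) i :
  0 <= a i -> I i -> a i <= \esum_(i in I) a i.
Proof.
move=> ai Ii; apply: esum_ge; exists [set i]; last by rewrite fsbig_set1.
by split=> // _ ->.
Qed.

(** Also for an infinite factor, as the sums at exponents up to 1 diverge. *)
Lemma esumZl (T : choiceType) (I : set T) (c : \bar R) (a : T -> \bar R) :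
  0 <= c -> (forall i, 0 <= a i) ->
  \esum_(i in I) (c * a i) = c * \esum_(i in I) a i.
Proof.
move=> c0 a0; apply/eqP; rewrite eq_le esumZl_le//=.
have s0 : 0 <= \esum_(i in I) a i by apply: esum_ge0.
case: c c0 => [c c0| _ |//]; last first.
  have [i0|/existsNP[i /not_implyP[Ii /eqP ai]]] :=
      pselect (forall i, I i -> a i = 0).
    by rewrite esum1// mule0 esum_ge0// => i Ii; rewrite mule_ge0.
  have ai0 : 0 < a i by rewrite lt0e ai a0.
  apply: (@le_trans _ _ (+oo * a i)); first by rewrite (gt0_mulye ai0) leey.
  by apply: (le_esum_term (a := fun i => +oo * a i)) => //; rewrite mule_ge0.
have [->|c1] := eqVneq c 0%R; first by rewrite mul0e esum_ge0// => i Ii; rewrite mul0e.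
have cp : (0 < c)%R by rewrite lt_def c1 -lee_fin.
rewrite muleC -lee_pdivlMr// muleC.
apply: le_trans (esumZl_le _ _ _); last 2 first.
- by rewrite lee_fin invr_ge0 ltW.
- by move=> i; rewrite mule_ge0.
apply: le_esum => i _.
by rewrite muleA -EFinM mulVf// mul1e.
Qed.

Lemma esumM (T1 T2 : choiceType) (I : set T1) (J : set T2)
    (a : T1 -> \bar R) (b : T2 -> \bar R) :
  (forall i, 0 <= a i) -> (forall j, 0 <= b j) ->
  \esum_(k in I `*` J) (a k.1 * b k.2) =
  (\esum_(i in I) a i) * (\esum_(j in J) b j).
Proof.
move=> a0 b0; have -> : I `*` J = I `*`` (fun _ => J) by [].
rewrite -(esum_esum (a := fun i j => a i * b j)); last first.
  by move=> i j _ _; rewrite mule_ge0.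
under eq_esum => i _ do rewrite esumZl//.
rewrite muleC -esumZl//; last exact: esum_ge0.
by apply: eq_esum => i _; rewrite muleC.
Qed.

End esum_extra.

(** * Partition sums *)

Section partition_sum.
Context {R : realType}.
Implicit Types (tau : R[i]) (t : R) (u v : seq (nat * nat)).

Definition letter tau (p : nat * nat) : R[i] := p.1.+1%:R + p.2.+1%:R * tau.

Lemma Re_letter tau p : Re (letter tau p) = p.1.+1%:R + p.2.+1%:R * Re tau.
Proof. by rewrite ReD Re_nat Re_natM. Qed.

Lemma Im_letter tau p : Im (letter tau p) = p.2.+1%:R * Im tau.
Proof. by rewrite ImD Im_nat add0r Im_natM. Qed.

Lemma letter_good tau p : A0 tau -> good (letter tau p).
Proof.
move=> [u0 v1]; rewrite /good Re_letter Im_letter; apply/andP; split.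
  by apply: ler_wpDr; [rewrite mulr_ge0 | rewrite (ler1n R p.1.+1)].
by apply: (le_trans v1); rewrite ler_peMl// ?(le_trans ler01)// (ler1n R p.2.+1).
Qed.

Lemma all_good tau u : A0 tau -> all good (map (letter tau) u).
Proof. by move=> tA; elim: u => //= p u ->; rewrite letter_good. Qed.

Lemma alphabetP tau b : alphabet tau b <-> exists p, b = letter tau p.
Proof.
split=> [[m [n [m0 n0 ->]]]|[p ->]]; last by exists p.1.+1, p.2.+1.
by exists (m.-1, n.-1); rewrite /letter/= !prednK.
Qed.

Definition norm_word tau u : R := norm_deriv (map (letter tau) u).

Lemma norm_word_gt0 tau u : A0 tau -> 0 < norm_word tau u.
Proof. by move=> tA; apply: norm_deriv_gt0; apply: all_good. Qed.

Lemma norm_word_ge0 tau u : A0 tau -> 0 <= norm_word tau u.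
Proof. by move=> tA; rewrite ltW// norm_word_gt0. Qed.

Lemma norm_word_size tau u : A0 tau -> norm_word tau u <= (2 / 3) ^+ size u.
Proof.
by move=> tA; rewrite -(size_map (letter tau)); apply: norm_deriv_size; apply: all_good.
Qed.

Lemma norm_word_le1 tau u : A0 tau -> norm_word tau u <= 1.
Proof. by move=> tA; apply: norm_deriv_le1; apply: all_good. Qed.

(** Words are indexed by their coefficients, so that sums for different [tau] run
    over the same set. *)
Definition psum tau n t : \bar R :=
  (\esum_(u in [set u : seq (nat * nat) | size u = n]) (norm_word tau u `^ t)%:E)%E.

Lemma psum_ge0 tau n t : (0 <= psum tau n t)%E.
Proof. by apply: esum_ge0 => u _; rewrite lee_fin powR_ge0. Qed.

Lemma psum_gt0 tau n t : A0 tau -> (0 < psum tau n t)%E.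
Proof.
move=> tA; apply: lt_le_trans (le_esum_term (i := nseq n (0, 0)%N) _ _).
- by rewrite lte_fin powR_gt0// norm_word_gt0.
- by rewrite lee_fin powR_ge0.
- by rewrite /= size_nseq.
Qed.

Lemma psum0 tau t : A0 tau -> psum tau 0 t = 1%E.
Proof.
move=> tA; rewrite /psum (_ : [set u | _] = [set [::]]); last first.
  by apply/seteqP; split=> [u /size0nil ->//|_ ->].
rewrite esum_set1 ?lee_fin ?powR_ge0// /norm_word (_ : norm_deriv _ = 1) ?powR1//.
rewrite /norm_deriv (_ : [set _ | _ in _] = [set 1]) ?sup1//.
apply/seteqP; split=> [_ [z _ <-]|_ ->]/=; first by rewrite cmod1 expr1n.
by exists 0; [exact: X0|rewrite cmod1 expr1n].
Qed.

Lemma psum_addE (f : seq (nat * nat) -> \bar R) n m :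
  (\esum_(u in [set u | size u = (n + m)%N]) f u =
  \esum_(k in [set u | size u = n] `*` [set u | size u = m]) f (k.1 ++ k.2))%E.
Proof.
apply: reindex_esum; split.
- by move=> [u v] /= [<- <-]; rewrite size_cat.
- move=> [u v] [u' v'] /set_mem[/= su sv] /set_mem[/= su' sv'] /eqP.
  by rewrite eqseq_cat ?su ?su'// => /andP[/eqP-> /eqP->].
- move=> w /= sw; exists (take n w, drop n w); last by rewrite /= cat_take_drop.
  by split=> /=; rewrite ?size_drop ?size_takel ?sw ?leq_addr// addKn.
Qed.

Lemma psum_add_le tau n m t : A0 tau -> 0 <= t ->
  (psum tau (n + m) t <= psum tau n t * psum tau m t)%E.
Proof.
move=> tA t0; rewrite /psum psum_addE -esumM; last 2 first.
- by move=> u; rewrite lee_fin powR_ge0.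
- by move=> u; rewrite lee_fin powR_ge0.
apply: le_esum => -[u v] _ /=; rewrite -EFinM lee_fin -powRM ?norm_word_ge0//.
rewrite ge0_ler_powR// ?nnegrE ?norm_word_ge0 ?mulr_ge0 ?norm_word_ge0//.
by rewrite /norm_word map_cat norm_deriv_cat_le// all_good.
Qed.

Lemma psum_add_ge tau n m t : A0 tau -> 0 <= t ->
  (psum tau n t * psum tau m t <= (4 `^ t)%:E * psum tau (n + m) t)%E.
Proof.
move=> tA t0; rewrite /psum psum_addE -esumM; last 2 first.
- by move=> u; rewrite lee_fin powR_ge0.
- by move=> u; rewrite lee_fin powR_ge0.
rewrite -[leRHS]esumZl; last 2 first.
- by rewrite lee_fin powR_ge0.
- by move=> k; rewrite lee_fin powR_ge0.
apply: le_esum => -[u v] _ /=; rewrite -!EFinM lee_fin -!powRM ?norm_word_ge0//.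
rewrite ge0_ler_powR// ?nnegrE ?mulr_ge0 ?norm_word_ge0//.
by rewrite /norm_word map_cat norm_deriv_cat_ge// all_good.
Qed.

(** The bound (2/3)^n on the derivatives at level n turns into a uniform rate of
    decrease of the partition sums in the exponent. *)
Lemma psum_shift tau n s t : A0 tau -> s <= t ->
  (psum tau n t <= (((2 / 3) ^+ n) `^ (t - s))%:E * psum tau n s)%E.
Proof.
move=> tA st; rewrite -esumZl ?lee_fin ?powR_ge0//; last first.
  by move=> k; rewrite lee_fin powR_ge0.
apply: le_esum => u /= un; rewrite -EFinM lee_fin.
rewrite -[in leLHS](subrK s t) [leLHS]powRD; last first.
  by apply/implyP => _; rewrite gt_eqF// norm_word_gt0.
rewrite ler_wpM2r ?powR_ge0// ge0_ler_powR ?subr_ge0// ?nnegrE ?norm_word_ge0//.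
by rewrite -un norm_word_size.
Qed.

Lemma psum_antitone tau n s t : A0 tau -> s <= t -> (psum tau n t <= psum tau n s)%E.
Proof.
move=> tA st; apply: le_trans (psum_shift n tA st) _.
rewrite -[leRHS]mul1e lee_wpmul2r ?psum_ge0// lee_fin.
have pow1 : 1 = 1 `^ (t - s) by rewrite powR1.
rewrite [leRHS]pow1 ge0_ler_powR ?subr_ge0// ?nnegrE ?exprn_ge0 ?divr_ge0//.
rewrite exprn_ile1 ?divr_ge0//.
by rewrite ler_pdivrMr// mul1r ler_nat.
Qed.

(** The exponential function lies above its tangents. *)
Lemma powR_tangent (x s t : R) : 0 < x -> x `^ s * (1 + (t - s) * ln x) <= x `^ t.
Proof.
move=> x0; rewrite /powR gt_eqF// -[X in _ <= expR (X * _)](subrKC s t) [in leRHS]mulrDl expRD.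
by rewrite ler_wpM2l ?expR_ge0// expR_ge1Dx.
Qed.

Lemma powR_convex (x l s t : R) : 0 < x -> 0 <= l <= 1 ->
  x `^ (l * s + (1 - l) * t) <= l * x `^ s + (1 - l) * x `^ t.
Proof.
move=> x0 /andP[l0 l1]; set m := l * s + (1 - l) * t.
have l1' : 0 <= 1 - l by rewrite subr_ge0.
have := lerD (ler_wpM2l l0 (powR_tangent m s x0)) (ler_wpM2l l1' (powR_tangent m t x0)).
apply: le_trans; rewrite le_eqVlt; apply/orP; left; apply/eqP.
by rewrite /m; ring.
Qed.

Lemma psum_convex tau n (l s t : R) : A0 tau -> 0 <= l <= 1 ->
  (psum tau n (l * s + (1 - l) * t) <=
   l%:E * psum tau n s + (1 - l)%:E * psum tau n t)%E.
Proof.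
move=> tA l01; have /andP[l0 l1] := l01.
rewrite -!esumZl ?lee_fin ?subr_ge0//; last 2 first.
- by move=> k; rewrite lee_fin powR_ge0.
- by move=> k; rewrite lee_fin powR_ge0.
rewrite -esumD; last 2 first.
- by move=> u _; rewrite -EFinM lee_fin mulr_ge0 ?powR_ge0.
- by move=> u _; rewrite -EFinM lee_fin mulr_ge0 ?powR_ge0 ?subr_ge0.
apply: le_esum => u _; rewrite -!EFinM -EFinD lee_fin.
by apply: powR_convex => //; apply: norm_word_gt0.
Qed.

End partition_sum.

(** * The coding map and the lower bound for the Hausdorff measure *)

Section real_lemmas.
Context {R : realType}.

(** The limit is the supremum of the lower ends of the intervals around the terms. *)
Lemma nested_limit (a e : nat -> R) :
  (forall n m, (n <= m)%N -> `|a m - a n| <= e n) -> (forall n, 0 <= e n) ->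
  exists l, forall n, `|a n - l| <= e n.
Proof.
move=> ae e0; pose S := range (fun n => a n - e n).
have ub m : ubound S (a m + e m).
  move=> _ [n _ <-]; have [nm|mn] := leP n m.
    by have := ae _ _ nm; have := e0 m; rewrite ler_norml => ? /andP[]; lra.
  by have := ae _ _ (ltnW mn); have := e0 n; rewrite ler_norml => ? /andP[]; lra.
exists (sup S) => n; rewrite ler_norml; apply/andP; split.
  have : sup S <= a n + e n by apply: ge_sup => //; exists (a 0%N - e 0%N), 0%N.
  by lra.
have : a n - e n <= sup S by apply: ub_le_sup; [exists (a 0%N + e 0%N); exact: ub|exists n].
by lra.
Qed.

Lemma geometric_small (q c e : R) : 0 <= q < 1 -> 0 < e -> exists n, c * q ^+ n < e.
Proof.
move=> /andP[q0 q1] e0.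
have : (fun n => c * q ^+ n) @ \oo --> c * 0.
  by apply: cvgM; [exact: cvg_cst | apply: cvg_expr; rewrite ger0_norm].
rewrite mulr0 => /cvgrPdist_lt /(_ _ e0)[n _ /(_ n (leqnn _))].
by rewrite sub0r normrN => h; exists n; apply: le_lt_trans h; exact: ler_norm.
Qed.

Lemma le_add_geometric (x y c : R) :
  (forall n, x <= y + c * (2 / 3) ^+ n) -> x <= y.
Proof.
move=> xy; apply/ler_addgt0Pr => e e0.
have [|n nP] := @geometric_small (2 / 3) c e _ e0; first by lra.
by have := xy n; lra.
Qed.

Lemma common_positive (T : eqType) (s : seq T) (P : T -> R -> Prop) :
  (forall i d d', d' <= d -> P i d -> P i d') ->
  (forall i, i \in s -> exists2 d, 0 < d & P i d) ->
  exists2 d, 0 < d & forall i, i \in s -> P i d.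
Proof.
move=> Pd; elim: s => [|i s IH] sP; first by exists 1.
have [d d0 dP] : exists2 d, 0 < d & P i d by apply: sP; rewrite mem_head.
have [|d' d'0 d'P] := IH; first by move=> j js; apply: sP; rewrite inE js orbT.
exists (Num.min d d'); first by rewrite lt_min d0.
move=> j; rewrite inE => /predU1P[->|js].
  by apply: Pd dP; rewrite ge_min lexx.
by apply: Pd (d'P _ js); rewrite ge_min lexx orbT.
Qed.

End real_lemmas.

Section coding.
Context {R : realType}.
Context (tau : R[i]) (tauA : A0 tau).
Implicit Types (x y z : R[i]) (t : R) (u v w : seq (nat * nat)).

Local Notation phiw u := (phi_word (map (letter tau) u)).

Let tau_good u : all good (map (letter tau) u). Proof. exact: all_good. Qed.

Lemma phiw_contract u x y : X x -> X y ->
  cmod (phiw u x - phiw u y) <= (2 / 3) ^+ size u * cmod (x - y).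
Proof.
move=> Xx Xy; apply: le_trans (phi_word_contract (tau_good u) Xx Xy) _.
by rewrite ler_wpM2r ?cmod_ge0// norm_word_size.
Qed.

Lemma mkseqD (p : nat -> nat * nat) n m :
  mkseq p (n + m) = mkseq p n ++ mkseq (fun k => p (n + k)%N) m.
Proof.
by rewrite /mkseq iotaD map_cat add0n; congr cat; rewrite -[n in iota n]addn0 iotaDl -map_comp.
Qed.

(** The images of 0 under the prefixes of [p] form a Cauchy sequence. *)
Lemma coding_exists (p : nat -> nat * nat) : exists x,
  X x /\ forall n, cmod (phiw (mkseq p n) 0 - x) <= 2 * (2 / 3) ^+ n.
Proof.
pose a n := phiw (mkseq p n) 0.
have q0 n : 0 <= (2 / 3) ^+ n :> R by rewrite exprn_ge0// divr_ge0.
have aa n m : (n <= m)%N -> cmod (a m - a n) <= (2 / 3) ^+ n.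
  move=> /subnKC<-; rewrite /a mkseqD map_cat phi_word_cat.
  have Xm := phi_word_X (tau_good (mkseq (fun k => p (n + k)%N) (m - n))) X0.
  apply: le_trans (phiw_contract _ Xm X0) _.
  by rewrite size_mkseq ler_piMr// X_diam//; exact: X0.
have [|//|l1 l1P] := @nested_limit R (fun n => Re (a n)) (fun n => (2 / 3) ^+ n).
  by move=> n m nm; rewrite -ReB; apply: le_trans (Re_cmod _) (aa _ _ nm).
have [|//|l2 l2P] := @nested_limit R (fun n => Im (a n)) (fun n => (2 / 3) ^+ n).
  by move=> n m nm; rewrite -ImB; apply: le_trans (Im_cmod _) (aa _ _ nm).
have al n : cmod (a n - (l1 +i* l2)%C) <= 2 * (2 / 3) ^+ n.
  apply: le_trans (cmod_le_ReIm _) _; rewrite ReB ImB /= mulr_natl mulr2n.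
  by rewrite lerD.
exists (l1 +i* l2)%C; split => //.
rewrite /X/=; apply: (@le_add_geometric _ _ _ 2) => n.
apply: le_trans (cmod_dist_triangle (a n) _ _) _; rewrite addrC.
rewrite (cmod_distC _ (a n)) lerD//.
by have := phi_word_X (tau_good (mkseq p n)) X0.
Qed.

Definition coding p : R[i] := sval (cid (coding_exists p)).

Lemma coding_X p : X (coding p).
Proof. by rewrite /coding; case: cid => x /= []. Qed.

Lemma coding_approx p n : cmod (phiw (mkseq p n) 0 - coding p) <= 2 * (2 / 3) ^+ n.
Proof. by rewrite /coding; case: cid => x /= []. Qed.

Lemma coding_shift p n :
  coding p = phiw (mkseq p n) (coding (fun k => p (n + k)%N)).
Proof.
apply/eqP; rewrite -subr_eq0 -cmod_eq0 eq_le cmod_ge0 andbT.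
apply: (@le_add_geometric _ _ _ 4) => m; rewrite add0r.
set q := fun k => _; have Xm := phi_word_X (tau_good (mkseq q m)) X0.
apply: le_trans (cmod_dist_triangle (phiw (mkseq p (n + m)) 0) _ _) _.
have q23 k : (2 / 3) ^+ k <= 1 :> R by rewrite exprn_ile1 ?divr_ge0//; lra.
have q0 k : 0 <= (2 / 3) ^+ k :> R by rewrite exprn_ge0// divr_ge0.
have h1 : cmod (coding p - phiw (mkseq p (n + m)) 0) <= 2 * (2 / 3) ^+ m.
  rewrite cmod_distC; apply: le_trans (coding_approx _ _) _.
  by rewrite ler_wpM2l// exprD ler_piMl.
have h2 : cmod (phiw (mkseq p (n + m)) 0 - phiw (mkseq p n) (coding q)) <= 2 * (2 / 3) ^+ m.
  rewrite mkseqD map_cat phi_word_cat.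
  apply: le_trans (phiw_contract _ Xm (coding_X q)) _.
  rewrite size_mkseq; apply: le_trans (coding_approx q m).
  by rewrite ler_piMl ?cmod_ge0.
by have := lerD h1 h2; lra.
Qed.

Lemma coding_limit_set p : limit_set tau (coding p).
Proof.
exists (letter tau \o p); first by move=> k; apply/alphabetP; exists (p k).
move=> n _; exists (coding (fun k => p (n + k)%N)); first exact: coding_X.
by rewrite [RHS](coding_shift p n) /mkseq map_comp.
Qed.

Lemma limit_set_sub n : (0 < n)%N ->
  limit_set tau `<=` \bigcup_(u in [set u | size u = n]) (phiw u @` X).
Proof.
move=> n0 x [w wA wx].
have /choice[p pP] : forall k, exists p, w k = letter tau p.
  by move=> k; apply/alphabetP; apply: wA.
exists (mkseq p n); first by rewrite /= size_mkseq.
rewrite (_ : map _ _ = mkseq w n); first exact: wx.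
by rewrite /mkseq -map_comp; apply: eq_map => k; rewrite /= pP.
Qed.

(** The disk [X] touches its translates by 1 and by i, hence the images of distinct
    generators may touch. This cannot happen for the images of [core], a set that
    contains the images of all the generators: its translates by distinct letters are at
    distance at least 1/6. *)
Definition core : set R[i] := [set z | [/\ X z, Re z <= 5 / 6 & Im z <= 0]].

Lemma core_X z : core z -> X z. Proof. by case. Qed.

Lemma phi_core p z : X z -> core (phi (letter tau p) z).
Proof.
move=> Xz; have gp := letter_good p tauA.
by split; [exact: phi_X | exact: phi_Re_le | exact: phi_Im_le0].
Qed.

Lemma phiw_core u z : core z -> core (phiw u z).
Proof. by elim: u => //= p u IH /IH [Xz _ _]; apply: phi_core. Qed.

Lemma coding_core p : core (coding p).
Proof. by rewrite (coding_shift p 1) /=; apply: phi_core; apply: coding_X. Qed.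

Lemma letter_separated p q x y : p != q -> core x -> core y ->
  6^-1 <= cmod (x + letter tau p - (y + letter tau q)).
Proof.
(* Order the two letters lexicographically, the imaginary coefficient coming first. *)
wlog pq : p q x y / (p.2 < q.2)%N || (p.2 == q.2) && (p.1 < q.1)%N.
  move=> H npq cx cy; have [/H|] := boolP ((p.2 < q.2)%N || (p.2 == q.2) && (p.1 < q.1)%N).
    exact.
  move=> nlt; rewrite cmod_distC; apply: H => //; last by rewrite eq_sym.
  move: npq nlt; case: (p) (q) => [p1 p2] [q1 q2]/=; rewrite xpair_eqE; lia.
move=> _ [Xx x1 x2] [Xy y1 y2].
have [u0 v1] := tauA.
have [x3 y3] := (X_Re_ge0 Xx, X_Re_ge0 Xy).
have [x4 y4] := (X_Im_ge Xx, X_Im_ge Xy).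
have [lt2|] := boolP (p.2 < q.2)%N.
  apply: le_trans (Im_cmod _); rewrite -normrN; apply: le_trans (ler_norm _).
  rewrite ImB (ImD x) (ImD y) !Im_letter.
  have : p.2.+1%:R + 1 <= q.2.+1%:R :> R by rewrite natr1 ler_nat.
  nra.
move: pq => /orP[->//|/andP[/eqP e2 lt1] _].
apply: le_trans (Re_cmod _); rewrite -normrN; apply: le_trans (ler_norm _).
rewrite ReB (ReD x) (ReD y) !Re_letter e2.
have : p.1.+1%:R + 1 <= q.1.+1%:R :> R by rewrite natr1 ler_nat.
lra.
Qed.

Lemma den_le p x : X x -> cmod (x + letter tau p) <= 1 + cmod (letter tau p).
Proof.
move=> Xx; apply: le_trans (cmod_triangle _ _) _; rewrite lerD2r.
by have := X_diam Xx X0; rewrite subr0.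
Qed.

(** Words of the same length that differ have images of [core] at positive distance;
    at the first letter at which they differ this is [letter_separated]. *)
Lemma words_separated u v : size u = size v -> u != v ->
  exists2 d : R, 0 < d &
    forall x y, core x -> core y -> d <= cmod (phiw u x - phiw v y).
Proof.
have D0 p : 0 < 1 + cmod (letter tau p) by rewrite ltr_pwDl ?cmod_ge0.
have den p x : core x -> x + letter tau p != 0.
  move=> /core_X Xx; rewrite -cmod_gt0.
  by apply: lt_le_trans (good_den1 (letter_good p tauA) Xx).
have step p q (d : R) x y : 0 <= d -> core x -> core y ->
    d <= cmod (x + letter tau p - (y + letter tau q)) ->
    d / ((1 + cmod (letter tau p)) * (1 + cmod (letter tau q))) <=
      cmod (phi (letter tau p) x - phi (letter tau q) y).
  move=> d0 cx cy dxy.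
  have -> : phi (letter tau p) x - phi (letter tau q) y =
      - ((x + letter tau p - (y + letter tau q)) / ((x + letter tau p) * (y + letter tau q))).
    by rewrite /phi; field; rewrite !den.
  rewrite cmodN cmodM cmodV cmodM ler_pM//.
    by rewrite invr_ge0 mulr_ge0 ?addr_ge0 ?cmod_ge0.
  rewrite lef_pV2 ?posrE ?mulr_gt0 ?cmod_gt0 ?den//.
  by rewrite ler_pM ?cmod_ge0// den_le//; apply: core_X.
elim: u v => [|p u IH] [|q v] //= [suv]; rewrite eqseq_cons negb_and.
have [<-{q} /= uv|pq _] := eqVneq p q.
  have [d d0 dP] := IH _ suv uv.
  exists (d / ((1 + cmod (letter tau p)) * (1 + cmod (letter tau p)))).
    by rewrite divr_gt0// mulr_gt0.
  move=> x y cx cy; apply: step; rewrite ?(ltW d0)//; try exact: phiw_core.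
  by rewrite opprD addrACA subrr addr0; apply: dP.
exists (6^-1 / ((1 + cmod (letter tau p)) * (1 + cmod (letter tau q)))).
  by rewrite divr_gt0 ?mulr_gt0 ?invr_gt0.
move=> x y cx cy; have [cu cv] := (phiw_core u cx, phiw_core v cy).
by apply: step; rewrite ?invr_ge0// letter_separated.
Qed.

End coding.

Lemma concat_blocks (T : eqType) (x0 : T) (us : nat -> seq T) N : (0 < N)%N ->
  (forall n, size (us n) = (n * N)%N) ->
  (forall n, exists w, us n.+1 = us n ++ w) ->
  exists p : nat -> T, forall n, mkseq p (size (us n)) = us n.
Proof.
move=> N0 us_size us_cat; exists (fun k => nth x0 (us k.+1) k) => n.
have mono m k i : (i < size (us m))%N -> nth x0 (us (m + k)%N) i = nth x0 (us m) i.
  move=> im; elim: k => [|k IH]; first by rewrite addn0.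
  have [w wE] := us_cat (m + k)%N.
  rewrite addnS wE nth_cat IH ifT// us_size; apply: leq_trans im _.
  by rewrite us_size leq_mul2r leq_addr orbT.
apply: (@eq_from_nth _ x0); first by rewrite size_mkseq.
move=> i; rewrite size_mkseq => iu; rewrite nth_mkseq//.
have iS : (i < size (us i.+1))%N by rewrite us_size leq_pmulr.
have [ni|/ltnW ni] := leqP n i.+1.
  by rewrite -(subnKC ni) mono.
by rewrite -(subnKC ni) mono// subnKC.
Qed.

Section lower_bound.
Context {R : realType} (tau : R[i]) (tauA : A0 tau).
Implicit Types (x y z : R[i]) (t : R) (u v w : seq (nat * nat)).

Local Notation phiw u := (phi_word (map (letter tau) u)).

Let tau_good u : all good (map (letter tau) u). Proof. exact: all_good. Qed.

Lemma phiw_expand u x y : X x -> X y ->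
  norm_word tau u / 4 * cmod (x - y) <= cmod (phiw u x - phiw u y).
Proof. exact: phi_word_expand. Qed.

(** A mass distribution argument without a measure. For a set [U k] of a cover, of size
    [d k], say that it is charged to the word [u] if it meets the image under [u] of
    [core]. If the sets charged to [u] have too small a total, then none of them is large
    enough to be charged to two of the words extending [u] by a block of [W], so by
    pigeonhole the same holds for one of these extensions. The point of the limit
    set produced in this way lies in none of the [U k]. *)
Lemma cover_lower_bound (W : seq (seq (nat * nat))) N s : 0 <= s -> (0 < N)%N ->
  uniq W -> (forall w, w \in W -> size w = N) ->
  1 <= \sum_(w <- W) (norm_word tau w / 4) `^ s ->
  exists2 c : R, 0 < c & forall (U : nat -> set R[i]) (d : nat -> R),
    (forall k, 0 < d k) ->
    (forall k x y, U k x -> U k y -> cmod (x - y) <= d k) ->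
    limit_set tau `<=` \bigcup_k U k ->
    (c%:E <= \sum_(k <oo) (d k `^ s)%:E)%E.
Proof.
move=> s0 N0 Wuniq Wsize Wsum.
(* [delta] is a lower bound for the gaps between the images of [core] under [W]. *)
have [delta delta0 gap] : exists2 d : R, 0 < d &
    forall uv, uv \in [seq (u, v) | u <- W, v <- W] ->
    uv.1 != uv.2 -> forall x y, core x -> core y -> d <= cmod (phiw uv.1 x - phiw uv.2 y).
  apply: common_positive => [uv d d' dd' H ne x y cx cy|[u v]].
    by apply: le_trans dd' _; apply: H.
  move=> /allpairsP[[u' v'] /= [uW vW [-> ->]]].
  have [->|ne] := eqVneq u' v'; first by exists 1 => //; rewrite eqxx.
  have [|d d0 dP] := words_separated tauA _ ne; first by rewrite !Wsize.
  by exists d => // _; exact: dP.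
exists (delta `^ s); first by rewrite powR_gt0.
move=> U d d0 Ud cov; rewrite leNgt; apply/negP => small.
pose hit u k := `[< exists2 x, core x & U k (phiw u x) >].
pose S u := (\sum_(k <oo) (if hit u k then (d k `^ s)%:E else 0))%E.
have term0 u k : (0 <= if hit u k then (d k `^ s)%:E else 0)%E.
  by case: ifP => //; rewrite lee_fin powR_ge0.
have term_le u k : hit u k -> ((d k `^ s)%:E <= S u)%E.
  move=> huk; apply: le_trans (nneseries_lim_ge k.+1 _); last by move=> *; exact: term0.
  rewrite big_nat_recr//= huk leeDr// sume_ge0// => i _; exact: term0.
(* In a pair [ur], the second entry is a lower bound for the contraction ratio of the
   word [ur.1], namely the product of those of its blocks. *)
pose Q (ur : seq (nat * nat) * R) := [/\ 0 < ur.2,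
  forall x y, X x -> X y -> ur.2 * cmod (x - y) <= cmod (phiw ur.1 x - phiw ur.1 y)
  & (S ur.1 < ((ur.2 * delta) `^ s)%:E)%E].
pose nxt (ur : seq (nat * nat) * R) w := (ur.1 ++ w, ur.2 * (norm_word tau w / 4)).
have Qstep ur : exists w, Q ur -> w \in W /\ Q (nxt ur w).
  have [Qur|nQ] := pselect (Q ur); last by exists [::].
  have [r0 exp_u Su] := Qur.
  apply: contrapT => /forallNP noQ.
  have big w : w \in W ->
      (((ur.2 * (norm_word tau w / 4) * delta) `^ s)%:E <= S (ur.1 ++ w))%E.
    move=> wW; rewrite leNgt; apply/negP => Sw; apply: (noQ w) => _; split => //.
    have nw := norm_word_gt0 w tauA.
    split => //=; first by rewrite mulr_gt0// divr_gt0.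
    move=> x y Xx Xy; rewrite map_cat !phi_word_cat.
    apply: le_trans (exp_u _ _ (phi_word_X (tau_good w) Xx) (phi_word_X (tau_good w) Xy)).
    by rewrite -mulrA ler_pM2l// phiw_expand.
  (* No [U k] charged to two children of [ur.1]: its size would be at least
     [ur.2 * delta], too large by itself for the total [S ur.1]. *)
  have split_le : (\sum_(w <- W) S (ur.1 ++ w) <= S ur.1)%E.
    rewrite /S -nneseries_sum; last by move=> *; exact: term0.
    apply: lee_nneseries => [k _ _|k _]; first by apply: sume_ge0 => *; exact: term0.
    have [/hasP[w wW hw]|/hasPn noh] := boolP (has (fun w => hit (ur.1 ++ w) k) W); last first.
      rewrite big1_seq; first exact: term0.
      by move=> w /andP[_ /noh /negbTE ->].
    have hu : hit ur.1 k.
      move/asboolP : hw => [x cx Ux]; apply/asboolP; exists (phiw w x).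
        exact: phiw_core.
      by rewrite -phi_word_cat -map_cat.
    rewrite hu (bigD1_seq w)//= hw big1_seq ?adde0// => w' /andP[w'w w'W].
    case: ifPn => // hw'; exfalso.
    have dk : ur.2 * delta <= d k.
      move/asboolP : hw => [x cx Ux]; move/asboolP : hw' => [y cy Uy].
      apply: le_trans (Ud _ _ _ Ux Uy); rewrite !map_cat !phi_word_cat.
      have [Xx Xy] := (core_X (phiw_core tauA w cx), core_X (phiw_core tauA w' cy)).
      apply: le_trans (exp_u _ _ Xx Xy).
      rewrite ler_pM2l//; apply: (gap (w, w')) => //=; last by rewrite eq_sym.
      by apply/allpairsP; exists (w, w').
    have := le_lt_trans (term_le _ _ hu) Su; rewrite lte_fin ltNge => /negP; apply.
    by apply: ge0_ler_powR => //; rewrite nnegrE ?mulr_ge0 // ltW.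
  have : (((ur.2 * delta) `^ s)%:E <= S ur.1)%E.
    apply: le_trans split_le.
    apply: (@le_trans _ _ (\sum_(w <- W) ((ur.2 * (norm_word tau w / 4) * delta) `^ s)%:E)%E).
      rewrite sumEFin lee_fin.
      rewrite (eq_bigr (fun w => (ur.2 * delta) `^ s * (norm_word tau w / 4) `^ s)).
        by rewrite -mulr_sumr ler_peMr// powR_ge0.
      move=> w _; rewrite -powRM ?mulr_ge0 ?ltW ?invr_gt0 ?norm_word_gt0//.
      by congr (_ `^ _); ring.
    by rewrite big_seq [leRHS]big_seq; apply: lee_sum => w wW; exact: big.
  by rewrite leNgt Su.
have /choice[next nextP] := Qstep.
pose st := fix st n := if n is m.+1 then nxt (st m) (next (st m)) else ([::], 1 : R).
have Qst n : Q (st n).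
  elim: n => [|n IH]; last by case: (nextP _ IH).
  split=> //= [x y Xx Xy|]; first by rewrite mul1r.
  rewrite mul1r; apply: le_lt_trans small; apply: lee_nneseries => // k _.
  by case: ifP => // _; rewrite lee_fin powR_ge0.
have size_st n : size (st n).1 = (n * N)%N.
  elim: n => //= n IH; rewrite size_cat IH mulSn addnC; congr addn.
  by apply: Wsize; case: (nextP _ (Qst n)).
have r_st n : (st n).2 <= 4^-1 ^+ n.
  elim: n => //= n IH; rewrite exprSr ler_pM//.
  - by case: (Qst n) => /ltW.
  - by rewrite divr_ge0// ltW// norm_word_gt0.
  - by rewrite -[leRHS]mul1r ler_wpM2r ?norm_word_le1.
have [|p pP] := @concat_blocks _ (0, 0)%N (fun n => (st n).1) N N0 size_st.
  by move=> n; exists (next (st n)).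
have [k _ Uk] := cov _ (coding_limit_set tauA p).
have [|n] := @geometric_small R 4^-1 delta (d k) _ (d0 k); first by lra.
rewrite mulrC => rn; have [r0 _ Sn] := Qst n.
have hk : hit (st n).1 k.
  apply/asboolP; exists (coding tauA (fun i => p (size (st n).1 + i)%N)).
    exact: coding_core.
  by have := coding_shift tauA p (size (st n).1); rewrite pP => <-.
have := le_lt_trans (term_le _ _ hk) Sn; rewrite lte_fin ltNge => /negP; apply.
have rd : (st n).2 * delta <= d k.
  by apply: le_trans (ltW rn); rewrite ler_wpM2r// ltW.
by apply: ge0_ler_powR => //; rewrite nnegrE ?mulr_ge0 // ltW.
Qed.

End lower_bound.

(** * Hausdorff measures of the limit set *)

Section hausdorff.
Context {R : realType}.
Local Open Scope ereal_scope.
Implicit Types (U : set R[i]) (s : R).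

Lemma diam_ge0 U : 0 <= diam U.
Proof. by apply: ereal_sup_ubound; left. Qed.

Lemma le_diam U x y : U x -> U y -> (cmod (x - y))%:E <= diam U.
Proof. by move=> Ux Uy; apply: ereal_sup_ubound; right; exists x => //; exists y. Qed.

Lemma diam_le U (r : R) : (0 <= r)%R ->
  (forall x y, U x -> U y -> (cmod (x - y) <= r)%R) -> diam U <= r%:E.
Proof.
move=> r0 Ur; apply: ge_ereal_sup => _ [->|[x Ux [y Uy <-]]]; rewrite lee_fin//.
exact: Ur.
Qed.

Lemma hausdorff_gauge_ge0 s U : 0 <= hausdorff_gauge s U.
Proof. by rewrite /hausdorff_gauge; case: ifP => // _; rewrite poweR_ge0. Qed.

Lemma hausdorff_gauge_le s U (r : R) : (0 <= s)%R -> (0 <= r)%R -> diam U <= r%:E ->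
  hausdorff_gauge s U <= (r `^ s)%:E.
Proof.
move=> s0 r0 Ur; rewrite /hausdorff_gauge; case: ifP => [_|_].
  by rewrite lee_fin powR_ge0.
rewrite -poweR_EFin gt0_ler_poweR// in_itv/= ?leey ?andbT ?diam_ge0//.
Qed.

Lemma hausdorff_premeasure_ge0 s delta (A : set R[i]) : 0 <= hausdorff_premeasure s delta A.
Proof.
apply: le_ereal_inf_tmp => _ [U _ <-]; apply: nneseries_ge0 => *.
exact: hausdorff_gauge_ge0.
Qed.

(** The lower bound for covers requires positive sizes, whereas a set may have diameter 0.
    The size [d] solves [d `^ s = diam U `^ s + e]. *)
Lemma inflate_diam s U (e : R) : (0 < s)%R -> (0 < e)%R -> diam U <= 1 ->
  exists d : R, [/\ (0 < d)%R, forall x y, U x -> U y -> (cmod (x - y) <= d)%R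
    & (d `^ s)%:E <= hausdorff_gauge s U + e%:E].
Proof.
move=> s0 e0 U1; have root (r : R) : (0 <= r)%R -> ((r `^ s^-1) `^ s)%R = r.
  by move=> r0; rewrite -powRrM mulVf ?gt_eqF// powRr1.
have [U0|U0] := eqVneq U set0.
  exists (e `^ s^-1)%R; split; first by rewrite powR_gt0.
    by move=> x y; rewrite U0.
  by rewrite (root _ (ltW e0)) /hausdorff_gauge U0 eqxx add0e.
have Ufin : diam U \is a fin_num.
  by rewrite ge0_fin_numE ?diam_ge0// (le_lt_trans U1) ?ltry.
have D0 : (0 <= fine (diam U))%R by rewrite fine_ge0 ?diam_ge0.
have DE : diam U = (fine (diam U))%:E by rewrite fineK.
set D := fine (diam U) in D0 DE.
have p0 : (0 <= D `^ s + e)%R by rewrite addr_ge0 ?powR_ge0 ?ltW.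
exists ((D `^ s + e) `^ s^-1)%R; split.
- by rewrite powR_gt0// ltr_wpDl ?powR_ge0.
- move=> x y Ux Uy; have := le_diam Ux Uy; rewrite DE lee_fin => /le_trans; apply.
  have DD : D = ((D `^ s) `^ s^-1)%R by rewrite -powRrM mulfV ?gt_eqF// powRr1.
  rewrite [leLHS]DD.
  by apply: ge0_ler_powR; rewrite ?invr_ge0 ?nnegrE ?powR_ge0 ?p0 ?lerDl ?ltW.
- by rewrite root// /hausdorff_gauge (negbTE U0) DE poweR_EFin -EFinD lexx.
Qed.

(** At exponent 0 every nonempty set of a cover contributes 1, whatever its size. *)
Lemma hausdorff_measure0_neq0 (A : set R[i]) : A !=set0 -> hausdorff_measure 0 A != 0.
Proof.
move=> [x Ax]; rewrite gt_eqF//; apply: (@lt_le_trans _ _ 1) => //.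
apply: (@le_trans _ _ (hausdorff_premeasure 0 1 A)); last first.
  by apply: ereal_sup_ubound; exists 1%R => //=.
apply: le_ereal_inf_tmp => _ [U [AU _] <-].
have [k _ Uk] := AU _ Ax.
apply: (@le_trans _ _ (hausdorff_gauge 0 (U k))).
  rewrite /hausdorff_gauge poweRe0 ifF//; apply/negP => /eqP U0.
  by move: Uk; rewrite U0.
apply: le_trans (nneseries_lim_ge k.+1 _); last by move=> *; exact: hausdorff_gauge_ge0.
by rewrite big_nat_recr//= leeDr// sume_ge0// => i _; exact: hausdorff_gauge_ge0.
Qed.

Lemma hausdorff_measure_eq0 s (A : set R[i]) :
  (forall delta e : R, (0 < delta)%R -> (0 < e)%R -> exists2 U : nat -> set R[i],
     A `<=` \bigcup_k U k /\ (forall k, diam (U k) <= delta%:E)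
     & \sum_(0 <= k <oo) hausdorff_gauge s (U k) <= e%:E) ->
  hausdorff_measure s A = 0.
Proof.
move=> H; apply/eqP; rewrite eq_le; apply/andP; split; last first.
  apply: le_trans (hausdorff_premeasure_ge0 s 1 A) _.
  by apply: ereal_sup_ubound; exists 1%R => //=.
apply: ge_ereal_sup => _ [delta /= delta0 <-].
apply/lee_addgt0Pr => e e0; rewrite add0e.
have [U UA Ue] := H _ _ delta0 e0.
by apply: le_trans Ue; apply: ereal_inf_lbound; exists U.
Qed.

Lemma hausdorff_measure_neq0 s (A : set R[i]) (c : R) : (0 < s)%R -> (0 < c)%R ->
  (forall (U : nat -> set R[i]) (d : nat -> R),
    (forall k, (0 < d k)%R) ->
    (forall k x y, U k x -> U k y -> (cmod (x - y) <= d k)%R) ->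
    A `<=` \bigcup_k U k ->
    c%:E <= \sum_(k <oo) (d k `^ s)%:E) ->
  hausdorff_measure s A != 0.
Proof.
move=> s0 c0 H; apply/eqP => HA0.
have c2 : (0 < c / 2)%R by rewrite divr_gt0.
have : hausdorff_premeasure s 1 A < (c / 2)%:E.
  apply: (@le_lt_trans _ _ 0); last by rewrite lte_fin.
  by rewrite -HA0; apply: ereal_sup_ubound; exists 1%R => //=.
move=> /ereal_inf_lt [_ [U [AU U1] <-] Uc].
have /choice[d dP] : forall k, exists d : R, [/\ (0 < d)%R,
    forall x y, U k x -> U k y -> (cmod (x - y) <= d)%R &
    (d `^ s)%:E <= hausdorff_gauge s (U k) + (c / 2 / (2 ^ k.+1)%:R)%:E].
  move=> k; apply: inflate_diam => //.
  by rewrite divr_gt0// ltr0n expn_gt0.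
have : c%:E <= \sum_(k <oo) (d k `^ s)%:E.
  by apply: H AU => [k|k x y Ux Uy]; have [? dU _] := dP k => //; exact: dU.
apply/negP; rewrite -ltNge.
apply: (@le_lt_trans _ _ (\sum_(k <oo) hausdorff_gauge s (U k) + (c / 2)%:E)).
  apply: le_trans (epsilon_trick xpredT _ (ltW c2)); last first.
    by move=> *; exact: hausdorff_gauge_ge0.
  apply: lee_nneseries => [k _ _|k _]; first by rewrite lee_fin powR_ge0.
  by case: (dP k).
rewrite [X in _ < X%:E](splitr c) EFinD lteD2rE//.
Qed.

End hausdorff.

Section hausdorff_limit_set.
Context {R : realType} (tau : R[i]) (tauA : A0 tau).

Local Notation phiw u := (phi_word (map (letter tau) u)).

Lemma psum_iter n k s : 0 <= s ->
  (psum tau (k * n) s <= psum tau n s ^+ k)%E.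
Proof.
move=> s0; elim: k => [|k IH]; first by rewrite mul0n psum0// expe0.
rewrite mulSn expeS; apply: le_trans (psum_add_le n _ tauA s0) _.
by rewrite lee_wpmul2l ?psum_ge0.
Qed.

(** The cover by the images of [X] under the words of length [n]; these are numbered by
    their codes, and the indices that code no such word get the empty set. *)
Lemma psum_cover n s (delta : R) : 0 <= s -> (0 < n)%N -> (2 / 3) ^+ n <= delta ->
  exists2 U : nat -> set R[i],
     limit_set tau `<=` \bigcup_k U k /\ (forall k, diam (U k) <= delta%:E)%E
     & (\sum_(0 <= k <oo) hausdorff_gauge s (U k) <= psum tau n s)%E.
Proof.
move=> s0 n0 n23.
have delta0 : 0 <= delta by apply: le_trans n23; rewrite exprn_ge0// divr_ge0.
pose I : set (seq (nat * nat)) := [set u | size u = n].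
pose U k : set R[i] := if (pickle_inv k : option (seq (nat * nat))) is Some u then
  if size u == n then phiw u @` X else set0 else set0.
have diam_word u : (diam (phiw u @` X) <= (norm_word tau u)%:E)%E.
  apply: diam_le; first exact: norm_word_ge0.
  move=> _ _ [x Xx <-] [y Xy <-].
  apply: le_trans (phi_word_contract (all_good u tauA) Xx Xy) _.
  by rewrite ler_piMr ?norm_word_ge0// X_diam.
have diam0 : (diam (set0 : set R[i]) <= 0)%E by apply: diam_le.
exists U.
  split=> [x /(limit_set_sub n0)[u /= un ux]|k].
    by exists (pickle u) => //; rewrite /U pickleK_inv un eqxx.
  have D0 : (diam (set0 : set R[i]) <= delta%:E)%E by apply: le_trans diam0 _.
  rewrite /U; case: pickle_inv => [u|//]; case: eqP => [un|//].
  apply: le_trans (diam_word u) _; rewrite lee_fin; apply: le_trans n23.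
  by rewrite -un norm_word_size.
rewrite nneseries_esumT; last by move=> *; exact: hausdorff_gauge_ge0.
rewrite [leRHS](_ : _ = \esum_(k in pickle @` I)
    (if (pickle_inv k : option (seq (nat * nat))) is Some u then
      (norm_word tau u `^ s)%:E else 0))%E; last first.
  rewrite esum_image; last by move=> u v _ _; apply: (pcan_inj pickleK_inv).
  by apply: eq_esum => u _; rewrite pickleK_inv.
rewrite [leRHS]esum_mkcond; apply: le_esum => k _.
have g0 : hausdorff_gauge s (set0 : set R[i]) = 0%E by rewrite /hausdorff_gauge eqxx.
rewrite /U; case E : (pickle_inv k : option (seq (nat * nat))) => [u|]; last first.
  by rewrite g0; case: ifP.
case: eqP => [un|_]; last by rewrite g0; case: ifP => // _; rewrite lee_fin powR_ge0.
rewrite ifT; first by apply: hausdorff_gauge_le => //; exact: norm_word_ge0.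
by apply/mem_set; exists u => //; have := @pickle_invK (seq (nat * nat)) k; rewrite E.
Qed.

Lemma hausdorff_measure_null n s : 0 <= s -> (0 < n)%N -> (psum tau n s < 1)%E ->
  hausdorff_measure s (limit_set tau) = 0%E.
Proof.
move=> s0 n0 p1; apply: hausdorff_measure_eq0 => delta e delta0 e0.
have pfin : psum tau n s \is a fin_num.
  by rewrite ge0_fin_numE ?psum_ge0// (lt_le_trans p1) ?leey.
set p := fine (psum tau n s); have pE : psum tau n s = p%:E by rewrite fineK.
have p01 : 0 <= p < 1.
  by rewrite -!lee_fin -lte_fin -pE psum_ge0 p1.
have [k1 k1P] := @geometric_small R (2 / 3) 1 delta ltac:(lra) delta0.
have [k2 k2P] := @geometric_small R p 1 e p01 e0.
set k := (k1 + k2).+1.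
have [| |U UA Us] := @psum_cover (k * n) s delta s0.
- by rewrite muln_gt0.
- apply: le_trans (ltW k1P); rewrite mul1r; apply: ler_wiXn2l; rewrite ?divr_ge0//.
    by rewrite ler_pdivrMr// mul1r ler_nat.
  by apply: leq_trans (leq_pmulr _ n0); rewrite /k; lia.
exists U => //; apply: le_trans Us _; apply: le_trans (psum_iter _ _ s0) _.
rewrite pE -EFin_expe lee_fin; apply: le_trans (ltW k2P); rewrite mul1r.
have /andP[pp0 pp1] := p01.
by apply: ler_wiXn2l => //; [exact: ltW | rewrite /k; lia].
Qed.

Lemma limit_set_nonempty : limit_set tau !=set0.
Proof. by exists (coding tauA (fun=> (0, 0)%N)); exact: coding_limit_set. Qed.

Lemma psum_gt_finite n s (r : R) : (r%:E < psum tau n s)%E ->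
  exists W : seq (seq (nat * nat)), [/\ uniq W, (forall w, w \in W -> size w = n) &
    r < \sum_(w <- W) norm_word tau w `^ s].
Proof.
move=> /ereal_sup_gt [_ [A [finA An] <-] rA].
exists (finmap.enum_fset (fset_set A)); split; first exact: finmap.fset_uniq.
  by move=> w; rewrite in_fset_set// => /set_mem /An.
by move: rA; rewrite fsbig_finite//= sumEFin lte_fin.
Qed.

(** The constant 4 is the distortion: the ratio of a word is at least [norm_word / 4]. *)
Lemma hausdorff_measure_pos n s : 0 <= s -> ((4 `^ s)%:E < psum tau n s)%E ->
  hausdorff_measure s (limit_set tau) != 0%E.
Proof.
move=> s0 ps; move: (s0); rewrite le_eqVlt => /predU1P[<-|sp].
  by apply: hausdorff_measure0_neq0; exact: limit_set_nonempty.
have n0 : (0 < n)%N.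
  case: n ps => //; rewrite psum0// lte_fin ltNge => /negP; case.
  have : 1 <= 4 :> R by rewrite ler1n.
  by move=> /(@ler_powR R) /(_ _ _ s0); rewrite powRr0.
have [W [Wu Wn Ws]] := psum_gt_finite ps.
have [|c c0 cP] := cover_lower_bound tauA s0 n0 Wu Wn.
  rewrite (eq_bigr (fun w => norm_word tau w `^ s * (4 `^ s)^-1)); last first.
    move=> w _; rewrite powRM ?norm_word_ge0 ?invr_ge0//; congr (_ * _).
    by rewrite -powR_inv1// -powRrM mulN1r powRN.
  by rewrite -mulr_suml ler_pdivlMr ?powR_gt0// mul1r ltW.
exact: hausdorff_measure_neq0 sp c0 cP.
Qed.

End hausdorff_limit_set.

(** * Estimates of the partition sums *)

Section series.
Context {R : realType}.

Lemma esum_telescope (f F : nat -> R) : (forall n, 0 <= f n) -> (forall n, 0 <= F n) ->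
  (forall n, f n <= F n - F n.+1) -> (\esum_(n in [set: nat]) (f n)%:E <= (F 0%N)%:E)%E.
Proof.
move=> f0 F0 fF; rewrite -nneseries_esumT; last by move=> n; rewrite lee_fin.
apply: lime_le; first by apply: is_cvg_nneseries => n _ _; rewrite lee_fin.
apply: nearW => n; rewrite sumEFin lee_fin.
apply: (@le_trans _ _ (F 0%N - F n)); last by rewrite gerBl.
elim: n => [|n IH]; first by rewrite subrr big_geq.
by rewrite big_nat_recr//=; have := fF n; lra.
Qed.

Lemma esum_telescope1 (f F : nat -> R) : (forall n, 0 <= f n) -> (forall n, 0 <= F n) ->
  (forall n, f n.+1 <= F n - F n.+1) ->
  (\esum_(n in [set: nat]) (f n)%:E <= (f 0%N + F 0%N)%:E)%E.
Proof.
move=> f0 F0 fF.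
apply: (@esum_telescope f (fun n => if n is m.+1 then F m else f 0%N + F 0%N)) => //.
  by case=> // ; rewrite addr_ge0.
by case=> [|n]; [rewrite addrK | exact: fF].
Qed.

(** With e = t - 1, the term (n + 2)^(-t) is at most the decrease of x^(-e) / e
    between n + 1 and n + 2: this is the tangent inequality for this convex function. *)
Lemma zeta_bound (t : R) : 1 < t ->
  (\esum_(n in [set: nat]) (n.+1%:R `^ (- t))%:E <= (1 + (t - 1)^-1)%:E)%E.
Proof.
move=> t1; set e := t - 1; have e0 : 0 < e by rewrite subr_gt0.
have := @esum_telescope1 (fun n => n.+1%:R `^ (- t)) (fun n => e^-1 * n.+1%:R `^ (- e)).
rewrite /= powR1 mulr1; apply => n; rewrite ?mulr_ge0 ?powR_ge0 ?invr_ge0 ?(ltW e0)//.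
rewrite -mulrBr; set x := n.+1%:R : R; set y := n.+2%:R : R.
have x0 : 0 < x by rewrite ltr0n.
have y0 : 0 < y by rewrite ltr0n.
have yx : y = x + 1 by rewrite /x /y natr1.
rewrite ler_pdivlMl//; rewrite [X in _ * X](_ : _ = y `^ (- e) * y^-1); last first.
  rewrite -[y^-1]powR_inv1 ?ltW// -powRD; last by rewrite (gt_eqF y0) implybT.
  by congr (_ `^ _); rewrite /e; ring.
suff : y `^ (- e) * (1 + e / y) <= x `^ (- e).
  by rewrite mulrDr mulr1 => le_y; rewrite lerBrDl mulrCA.
have -> : x `^ (- e) = y `^ (- e) * (y / x) `^ e.
  rewrite -[y / x]invf_div -powR_inv1 ?divr_ge0 ?ltW// -powRrM mulN1r.
  by rewrite -powRM ?divr_ge0 ?ltW// mulrCA mulfV ?mulr1// gt_eqF.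
rewrite ler_wpM2l ?powR_ge0// /powR gt_eqF ?divr_gt0//.
apply: le_trans (expR_ge1Dx _); rewrite lerD2l ler_wpM2l ?(ltW e0)//.
rewrite -[y / x]invf_div lnV ?posrE ?divr_gt0// lerNr.
have -> : x / y = 1 + (- y^-1) by rewrite -[x](addrK 1) -yx mulrBl mulfV ?gt_eqF// mul1r.
apply: le_ln1Dx; rewrite ltrNl opprK invf_lt1//.
by rewrite yx ltrDr.
Qed.

End series.

Section estimates.
Context {R : realType}.
Implicit Types (tau : R[i]) (p : nat * nat) (t : R).

Lemma psum1E tau t :
  psum tau 1 t = (\esum_(p in [set: nat * nat]) (norm_word tau [:: p] `^ t)%:E)%E.
Proof.
apply: reindex_esum; split=> //.
  by move=> p q _ _ [].
by move=> [|p [|q u]]//= _; exists p.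
Qed.

Lemma root_deriv1 b z : cmod (root_deriv [:: b] z) ^+ 2 = (cmod (z + b : R[i]) ^+ 2)^-1.
Proof. by rewrite /= mulr1 cmodM cmodi mul1r cmodV exprVn. Qed.

Lemma norm_letter_le tau p (r : R) : A0 tau -> 0 < r ->
  (forall z, X z -> r <= cmod (z + letter tau p) ^+ 2) -> norm_word tau [:: p] <= r^-1.
Proof.
move=> tA r0 H; apply: norm_deriv_le; first exact: (all_good [:: p]).
move=> z Xz; rewrite root_deriv1 lef_pV2 ?posrE ?H//.
by apply: lt_le_trans (H _ Xz).
Qed.

Lemma A0_cmod1 tau : A0 tau -> 1 <= cmod tau.
Proof.
by move=> [_ v1]; apply: le_trans (Im_cmod _); apply: le_trans v1 (ler_norm _).
Qed.

(** Put S = m + n |tau|, with m and n the coefficients of the letter. As |tau| is at most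
    the sum of the coordinates of tau, [cmod_den_ge] bounds the square of the denominator
    from below by (S - 1/4)^2 / 2 >= S^2 / 4 >= m n |tau|. *)
Lemma norm_letter_product tau p : A0 tau ->
  norm_word tau [:: p] <= (cmod tau)^-1 * (p.1.+1%:R^-1 * p.2.+1%:R^-1).
Proof.
move=> tA; have T1 := A0_cmod1 tA; have [u0 v1] := tA.
rewrite -invfM -invfM.
have m1 : 1 <= p.1.+1%:R :> R by rewrite ler1n.
have n1 : 1 <= p.2.+1%:R :> R by rewrite ler1n.
have Tuv : cmod tau <= Re tau + Im tau.
  by apply: le_trans (cmod_le_ReIm _) _; rewrite !ger0_norm//; lra.
apply: norm_letter_le => //; first by rewrite !mulr_gt0//; lra.
move=> z Xz; set m := p.1.+1%:R in m1 *; set n := p.2.+1%:R in n1 *.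
have S1 : m + n * cmod tau - 4^-1 <= Re (letter tau p) + Im (letter tau p) - 4^-1.
  rewrite Re_letter Im_letter -/m -/n; nra.
have S2 : 2 <= m + n * cmod tau by nra.
apply: le_trans (cmod_den_ge Xz _); last lra.
apply: (@le_trans _ _ ((m + n * cmod tau - 4^-1) ^+ 2 / 2)); last first.
  by rewrite ler_wpM2r// ler_sqr// nnegrE; lra.
have := sqr_ge0 (m - n * cmod tau); nra.
Qed.

Lemma psum1_product tau t : A0 tau -> 1 < t ->
  (psum tau 1 t <= ((cmod tau `^ t)^-1 * (1 + (t - 1)^-1) ^+ 2)%:E)%E.
Proof.
move=> tA t1; have T1 := A0_cmod1 tA; have t0 : 0 <= t by lra.
rewrite psum1E.
pose f n : \bar R := (n.+1%:R `^ (- t))%:E.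
have f0 n : (0 <= f n)%E by rewrite lee_fin powR_ge0.
apply: (@le_trans _ _ (\esum_(p in [set: nat * nat])
    (((cmod tau `^ t)^-1)%:E * (f p.1 * f p.2)))%E).
  apply: le_esum => p _; rewrite /f -!EFinM lee_fin.
  rewrite !powRN -!invfM -!powRM ?mulr_ge0 ?cmod_ge0//.
  rewrite -[leRHS]powR_inv1 ?powR_ge0// -powRrM [t * -1]mulrC powRrM.
  rewrite powR_inv1 ?mulr_ge0 ?cmod_ge0//.
  rewrite ge0_ler_powR// ?nnegrE ?norm_word_ge0 ?invr_ge0 ?mulr_ge0 ?cmod_ge0//.
  by rewrite !invfM; exact: norm_letter_product.
rewrite esumZl ?lee_fin ?invr_ge0 ?powR_ge0//; last by move=> p; rewrite mule_ge0.
rewrite EFinM lee_wpmul2l ?lee_fin ?invr_ge0 ?powR_ge0// -setXTT esumM// expr2 EFinM.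
by apply: lee_pmul; rewrite ?esum_ge0//; exact: zeta_bound.
Qed.

Lemma psum_lty tau n t : A0 tau -> 1 < t -> (psum tau n t < +oo)%E.
Proof.
move=> tA t1; have t0 : 0 <= t by lra.
elim: n => [|n IH]; first by rewrite psum0// ltry.
rewrite -addn1; apply: le_lt_trans (psum_add_le n 1 tA t0) _.
have p1 : (psum tau 1 t < +oo)%E by apply: le_lt_trans (psum1_product tA t1) _; rewrite ltry.
by rewrite lte_mul_pinfty ?psum_ge0// ge0_fin_numE ?psum_ge0.
Qed.

Lemma esum_harmonic : (\esum_(n in [set: nat]) ((n.+1%:R : R)^-1)%:E = +oo)%E.
Proof.
rewrite -nneseries_esumT; last by move=> n; rewrite lee_fin invr_ge0.
apply: contrapT => /eqP; rewrite -ltey => fin.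
apply: (@dvg_harmonic R); apply: nondecreasing_is_cvgn.
  apply: nondecreasing_series => n _ _; exact: harmonic_ge0.
have f0 n : (0 <= ((n.+1%:R : R)^-1)%:E)%E by rewrite lee_fin invr_ge0.
exists (fine (\sum_(n <oo) ((n.+1%:R : R)^-1)%:E)%E) => _ [n _ <-].
rewrite -lee_fin fineK; last by rewrite ge0_fin_numE// nneseries_ge0.
rewrite /series/= -sumEFin; exact: nneseries_lim_ge.
Qed.

Lemma letter_norm_ge tau p : A0 tau -> (p.2 <= p.1)%N ->
  ((1 + cmod tau) ^+ 2)^-1 * (p.1.+1%:R^-1 ^+ 2) <= norm_word tau [:: p].
Proof.
move=> tA np; have T1 := A0_cmod1 tA.
apply: le_trans (le_norm_deriv (all_good [:: p] tA) X0).
rewrite /= root_deriv1 add0r exprVn -invfM -exprMn.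
have b0 : 0 < cmod (letter tau p).
  have := good_den1 (letter_good p tA) X0; rewrite add0r; exact: lt_le_trans.
rewrite lef_pV2 ?posrE ?exprn_gt0 ?mulr_gt0 ?ltr0n//; last by lra.
rewrite ler_sqr ?nnegrE ?cmod_ge0 ?mulr_ge0//; last by lra.
apply: le_trans (cmod_triangle _ _) _; rewrite cmodM.
have cn n : cmod (n%:R : R[i]) = n%:R.
  by rewrite cmodE Re_nat Im_nat expr0n addr0 sqrtr_sqr ger0_norm.
rewrite !cn mulrDl mul1r mulrC lerD2l ler_wpM2l ?ler_nat//; lra.
Qed.

(** The sum over the triangle n <= m dominates a multiple of the harmonic series. *)
Lemma psum1_infinite tau : A0 tau -> psum tau 1 1 = +oo%E.
Proof.
move=> tA; have T1 := A0_cmod1 tA; apply/eqP; rewrite -leye_eq psum1E.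
set c : R := ((1 + cmod tau) ^+ 2)^-1.
have c0 : 0 < c by rewrite invr_gt0 exprn_gt0//; lra.
have -> : +oo%E = (\esum_(m in [set: nat]) (c%:E * ((m.+1%:R : R)^-1)%:E))%E.
  rewrite esumZl ?lee_fin ?(ltW c0)//.
  by rewrite esum_harmonic gt0_muley// lte_fin.
have -> : [set: nat * nat] = [set: nat] `*`` (fun _ => [set: nat]).
  by apply/seteqP.
rewrite -(esum_esum (a := fun m n => (norm_word tau [:: (m, n)] `^ 1)%:E)); last first.
  by move=> *; rewrite lee_fin powR_ge0.
apply: le_esum => m _; rewrite -nneseries_esumT; last by move=> n; rewrite lee_fin powR_ge0.
apply: le_trans (nneseries_lim_ge m.+1 _); last by move=> *; rewrite lee_fin powR_ge0.
rewrite sumEFin -EFinM lee_fin big_mkord.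
apply: (@le_trans _ _ (\sum_(i < m.+1) c * (m.+1%:R^-1 ^+ 2))).
  rewrite sumr_const card_ord -[leRHS]mulr_natl mulrCA ler_wpM2l ?(ltW c0)//.
  by rewrite expr2 mulrA mulfV ?mul1r.
apply: ler_sum => i _; rewrite powRr1 ?norm_word_ge0//.
by apply: (@letter_norm_ge tau (m, i : nat)) => //=; rewrite -ltnS.
Qed.

(** The midpoint rule underestimates the integral of a convex function. *)
Lemma inv4_telescope (x : R) : 2^-1 < x ->
  (x ^+ 4)^-1 <= 3^-1 * ((x - 2^-1) ^+ 3)^-1 - 3^-1 * ((x + 2^-1) ^+ 3)^-1.
Proof.
move=> x2; have a0 : 0 < x - 2^-1 by lra.
have b0 : 0 < x + 2^-1 by lra.
have -> : 3^-1 * ((x - 2^-1) ^+ 3)^-1 - 3^-1 * ((x + 2^-1) ^+ 3)^-1 =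
    (x ^+ 2 + 12^-1) / ((x - 2^-1) * (x + 2^-1)) ^+ 3.
  by field; rewrite !gt_eqF//; lra.
have ab0 : 0 < (x - 2^-1) * (x + 2^-1) by rewrite mulr_gt0.
rewrite ler_pdivlMr ?exprn_gt0// ler_pdivrMl ?exprn_gt0//; last by lra.
apply: (@le_trans _ _ ((x ^+ 2) ^+ 3)).
  by rewrite lerXn2r ?nnegrE ?sqr_ge0 ?(ltW ab0)//; lra.
by rewrite -exprM mulrDr -exprD lerDl mulr_ge0// exprn_even_ge0.
Qed.

Lemma inv3_telescope (x : R) : 2^-1 < x ->
  (x ^+ 3)^-1 <= 2^-1 * ((x - 2^-1) ^+ 2)^-1 - 2^-1 * ((x + 2^-1) ^+ 2)^-1.
Proof.
move=> x2; have a0 : 0 < x - 2^-1 by lra.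
have b0 : 0 < x + 2^-1 by lra.
have -> : 2^-1 * ((x - 2^-1) ^+ 2)^-1 - 2^-1 * ((x + 2^-1) ^+ 2)^-1 =
    x / ((x - 2^-1) * (x + 2^-1)) ^+ 2.
  by field; rewrite !gt_eqF//; lra.
have ab0 : 0 < (x - 2^-1) * (x + 2^-1) by rewrite mulr_gt0.
rewrite ler_pdivlMr ?exprn_gt0// ler_pdivrMl ?exprn_gt0//; last by lra.
apply: (@le_trans _ _ ((x ^+ 2) ^+ 2)).
  by rewrite lerXn2r ?nnegrE ?sqr_ge0 ?(ltW ab0)//; lra.
by rewrite -exprM -exprSr.
Qed.

End estimates.

Section area_estimate.
Context {R : realType}.
Implicit Types tau : R[i].

Lemma norm_letter_sum tau (i j : nat) : A0 tau ->
  norm_word tau [:: (i, j)] `^ 2 <= 4 * ((i%:R + j%:R + 7 / 4) ^+ 4)^-1.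
Proof.
move=> tA; set S : R := i%:R + j%:R + 7 / 4.
have [i0 j0] : 0 <= i%:R :> R /\ 0 <= j%:R :> R by rewrite !ler0n.
have S0 : 0 < S by rewrite /S; lra.
have Sb : S <= Re (letter tau (i, j)) + Im (letter tau (i, j)) - 4^-1.
  rewrite Re_letter Im_letter /= -[i.+1]addn1 -[j.+1]addn1 !natrD /S.
  have [u0 v1] := tA; nra.
have := @norm_letter_le R tau (i, j) (S ^+ 2 / 2) tA.
rewrite divr_gt0 ?exprn_gt0// => /(_ isT); set N := norm_word _ _ => NS.
have N0 : 0 <= N by exact: norm_word_ge0.
have {}NS : N <= 2 * (S ^+ 2)^-1.
  rewrite -[2 * _]invf_div; apply: NS => z Xz.
  apply: le_trans (cmod_den_ge Xz _); last by lra.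
  by rewrite ler_wpM2r// ler_sqr// nnegrE; lra.
rewrite (_ : 4 * _ = (2 * (S ^+ 2)^-1) ^+ 2); last first.
  by rewrite exprMn exprVn -exprM; congr (_ * _); rewrite -natrX.
by rewrite powR_mulrn// lerXn2r// nnegrE// mulr_ge0// invr_ge0 sqr_ge0.
Qed.

(** The terms 4 / (i + j + 7/4)^4 of the majorant are compared with integrals, first in
    [j] and then in [i], except that of the corner i = j = 0, for which the comparison
    would lose too much. *)
Lemma psum1_two tau : A0 tau -> (psum tau 1 2 < 1)%E.
Proof.
move=> tA; rewrite psum1E.
have -> : [set: nat * nat] = [set: nat] `*`` (fun _ => [set: nat]) by apply/seteqP.
rewrite -(esum_esum (a := fun i j => (norm_word tau [:: (i, j)] `^ 2)%:E)); last first.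
  by move=> *; rewrite lee_fin powR_ge0.
pose f (i j : nat) : R := 4 * ((i%:R + j%:R + 7 / 4) ^+ 4)^-1.
have f0 i j : 0 <= f i j by rewrite mulr_ge0// invr_ge0 exprn_ge0// !addr_ge0.
have f_tel (x : R) : 2^-1 < x -> 4 * (x ^+ 4)^-1 <=
    4 / 3 * ((x - 2^-1) ^+ 3)^-1 - 4 / 3 * ((x + 2^-1) ^+ 3)^-1.
  by move=> /inv4_telescope; lra.
have r_tel (x : R) : 2^-1 < x -> 4 / 3 * (x ^+ 3)^-1 <=
    2 / 3 * ((x - 2^-1) ^+ 2)^-1 - 2 / 3 * ((x + 2^-1) ^+ 2)^-1.
  by move=> /inv3_telescope; lra.
pose r (i : nat) : R := if i is k.+1 then 4 / 3 * ((k%:R + 9 / 4) ^+ 3)^-1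
  else 4 * ((7 / 4) ^+ 4)^-1 + 4 / 3 * ((9 / 4) ^+ 3)^-1.
have row i : (\esum_(j in [set: nat]) (norm_word tau [:: (i, j)] `^ 2)%:E <= (r i)%:E)%E.
  apply: (@le_trans _ _ (\esum_(j in [set: nat]) (f i j)%:E)%E).
    by apply: le_esum => j _; rewrite lee_fin norm_letter_sum.
  case: i => [|i].
    have := @esum_telescope1 R (f 0%N) (fun j => 4 / 3 * ((j%:R + 9 / 4) ^+ 3)^-1) (f0 0%N).
    rewrite /f /r !add0r; apply => j.
      by rewrite mulr_ge0// invr_ge0 exprn_ge0// addr_ge0.
    have j0 : 0 <= j%:R :> R by rewrite ler0n.
    have := @f_tel (j%:R + 11 / 4); rewrite -[j.+1]addn1 natrD add0r.
    rewrite (_ : j%:R + 11 / 4 - 2^-1 = j%:R + 9 / 4); last by lra.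
    rewrite (_ : j%:R + 11 / 4 + 2^-1 = j%:R + 1 + 9 / 4); last by lra.
    rewrite (_ : j%:R + 1 + 7 / 4 = j%:R + 11 / 4); last by lra.
    by apply; lra.
  have := @esum_telescope R (f i.+1) (fun j => 4 / 3 * ((i%:R + j%:R + 9 / 4) ^+ 3)^-1) (f0 _).
  rewrite /f /r !addr0; apply => j.
    by rewrite mulr_ge0// invr_ge0 exprn_ge0// !addr_ge0.
  have [i0 j0] : 0 <= i%:R :> R /\ 0 <= j%:R :> R by rewrite !ler0n.
  have := @f_tel (i%:R + j%:R + 11 / 4); rewrite -[j.+1]addn1 -[i.+1]addn1 !natrD.
  rewrite (_ : i%:R + j%:R + 11 / 4 - 2^-1 = i%:R + j%:R + 9 / 4); last by lra.
  rewrite (_ : i%:R + j%:R + 11 / 4 + 2^-1 = i%:R + (j%:R + 1) + 9 / 4); last by lra.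
  rewrite (_ : i%:R + 1 + j%:R + 7 / 4 = i%:R + j%:R + 11 / 4); last by lra.
  by apply; lra.
apply: (@le_lt_trans _ _ (\esum_(i in [set: nat]) (r i)%:E)%E).
  by apply: le_esum => i _; exact: row.
have r0 i : 0 <= r i.
  by case: i => [|i]; rewrite /r ?addr_ge0// mulr_ge0// invr_ge0 exprn_ge0// addr_ge0.
apply: le_lt_trans (@esum_telescope1 R r (fun i => 2 / 3 * ((i%:R + 7 / 4) ^+ 2)^-1) r0 _ _) _.
- by move=> i; rewrite mulr_ge0// invr_ge0 exprn_ge0// addr_ge0.
- move=> i; rewrite /r; have i0 : 0 <= i%:R :> R by rewrite ler0n.
  have := @r_tel (i%:R + 9 / 4); rewrite -[i.+1]addn1 natrD.
  rewrite (_ : i%:R + 9 / 4 - 2^-1 = i%:R + 7 / 4); last by lra.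
  rewrite (_ : i%:R + 9 / 4 + 2^-1 = i%:R + 1 + 7 / 4); last by lra.
  by apply; lra.
rewrite lte_fin /r add0r.
have -> : 4 * ((7 / 4) ^+ 4)^-1 = 1024 / 2401 :> R by field.
have -> : 4 / 3 * ((9 / 4) ^+ 3)^-1 = 256 / 2187 :> R by field.
have -> : 2 / 3 * ((7 / 4) ^+ 2)^-1 = 32 / 147 :> R by field.
(* 1024/2401 + 256/2187 + 32/147 is about 0.76. *)
lra.
Qed.

End area_estimate.

(** * Dependence of the derivatives on the parameter *)

Section perturbation.
Context {R : realType} (tau tau' : R[i]) (tauA : A0 tau) (tauA' : A0 tau').
Implicit Types (z : R[i]) (p : nat * nat) (u : seq (nat * nat)) (t : R).

Local Notation eta := (cmod (tau - tau')).
Local Notation phiw s u := (phi_word (map (letter s) u)).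

Lemma letter_sub p : cmod (letter tau p - letter tau' p) = p.2.+1%:R * eta.
Proof.
rewrite /letter opprD addrACA subrr add0r -mulrBr cmodM.
by rewrite cmodE Re_nat Im_nat expr0n addr0 sqrtr_sqr ger0_norm.
Qed.

Lemma den_ge_index (s : R[i]) p z : A0 s -> X z -> p.2.+1%:R <= 2 * cmod (z + letter s p).
Proof.
move=> [_ v1] /X_Im_ge z2.
have : Im (z + letter s p) <= cmod (z + letter s p).
  by apply: le_trans (ler_norm _) (Im_cmod _).
rewrite ImD Im_letter; have : 1 <= p.2.+1%:R :> R by rewrite ler1n.
by nra.
Qed.

(** The change of a letter is proportional to its second coefficient, which is at most
    twice the denominator; the maps being contractions, the errors do not accumulate
    along a word: 6 solves the equation (2/3) c + 2 = c. *)
Lemma phi_word_perturb u z : X z -> cmod (phiw tau u z - phiw tau' u z) <= 6 * eta.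
Proof.
move=> Xz; have e0 : 0 <= eta by exact: cmod_ge0.
elim: u => [|p u IH] /=; first by rewrite subrr cmod0 mulr_ge0.
set x := phiw tau u z in IH *; set y := phiw tau' u z in IH *.
have Xx : X x by apply: phi_word_X => //; apply: all_good.
have Xy : X y by apply: phi_word_X => //; apply: all_good.
have xd := good_den (letter_good p tauA) Xx; have yd := good_den (letter_good p tauA') Xy.
have xd1 := good_den1 (letter_good p tauA) Xx; have yd1 := good_den1 (letter_good p tauA') Xy.
have nx := den_ge_index p tauA Xx.
have num : cmod (y + letter tau' p - (x + letter tau p)) <= 6 * eta + p.2.+1%:R * eta.
  rewrite opprD addrACA; apply: le_trans (cmod_triangle _ _) _.
  apply: lerD; first by rewrite (cmod_distC y x).
  by rewrite (cmod_distC (letter tau' p)) letter_sub.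
have den0 (s : R[i]) w : 1 <= cmod (w + letter s p) -> w + letter s p != 0.
  by move=> h; rewrite -cmod_gt0; apply: lt_le_trans h.
have -> : phi (letter tau p) x - phi (letter tau' p) y =
    (y + letter tau' p - (x + letter tau p)) / ((x + letter tau p) * (y + letter tau' p)).
  by rewrite /phi; field; rewrite !den0.
rewrite cmodM cmodV cmodM.
set a := cmod (x + letter tau p) in xd xd1 nx *; set b := cmod (y + letter tau' p) in yd yd1 *.
rewrite ler_pdivrMr; last by rewrite mulr_gt0; lra.
apply: le_trans num _; set n := p.2.+1%:R in nx *.
have ab : 3 / 2 <= a * b.
  rewrite -ler_sqr ?nnegrE; [|lra|nra].
  by rewrite exprMn; have := sqr_ge0 a; nra.
have nb : n <= 2 * (a * b) by nra.
nra.
Qed.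

(** Each denominator changes by at most (6 + n) eta, where n is the second coefficient of
    the letter, hence by a factor at most 1 + 8 eta. *)
Lemma norm_word_perturb u : norm_word tau' u <= ((1 + 8 * eta) ^+ 2) ^+ size u * norm_word tau u.
Proof.
have e0 : 0 <= eta by exact: cmod_ge0.
have gu := all_good u tauA; have gu' := all_good u tauA'.
apply: norm_deriv_le => // z Xz.
apply: (@le_trans _ _ (((1 + 8 * eta) ^+ 2) ^+ size u *
    cmod (root_deriv (map (letter tau) u) z) ^+ 2)); last first.
  by rewrite ler_wpM2l ?exprn_ge0// ?addr_ge0 ?mulr_ge0// le_norm_deriv.
rewrite -exprM mulnC exprM -exprMn ler_sqr; last 2 first.
- by rewrite nnegrE cmod_ge0.
- by rewrite nnegrE mulr_ge0 ?cmod_ge0// exprn_ge0// addr_ge0// mulr_ge0.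
elim: u {gu gu'} => [|p u IH] /=; first by rewrite expr0 mul1r.
rewrite !cmodM cmodi !mul1r exprS mulrACA ler_pM ?cmod_ge0 ?IH//.
rewrite !cmodV.
have perturb := phi_word_perturb u Xz.
set x := phiw tau u z in perturb *; set y := phiw tau' u z in perturb *.
have Xx : X x by apply: phi_word_X => //; apply: all_good.
have Xy : X y by apply: phi_word_X => //; apply: all_good.
have xd1 := good_den1 (letter_good p tauA) Xx; have yd1 := good_den1 (letter_good p tauA') Xy.
have ny := den_ge_index p tauA' Xy.
have : cmod (x + letter tau p) <= cmod (y + letter tau' p) + (6 * eta + p.2.+1%:R * eta).
  apply: le_trans (cmod_sub_triangle _ (y + letter tau' p)) _; rewrite lerD2l.
  rewrite opprD addrACA; apply: le_trans (cmod_triangle _ _) _.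
  by rewrite lerD// letter_sub.
set a := cmod (x + letter tau p) in xd1 *; set b := cmod (y + letter tau' p) in yd1 ny *.
set n := p.2.+1%:R in ny * => ab.
rewrite ler_pdivlMr; last by lra.
rewrite mulrC ler_pdivrMr; last by lra.
nra.
Qed.

Lemma psum_perturb n t : 0 <= t ->
  (psum tau' n t <= ((((1 + 8 * eta) ^+ 2) ^+ n) `^ t)%:E * psum tau n t)%E.
Proof.
move=> t0; have e0 : 0 <= eta by exact: cmod_ge0.
have c0 : 0 <= ((1 + 8 * eta) ^+ 2) ^+ n by rewrite !exprn_ge0// addr_ge0// mulr_ge0.
rewrite -[leRHS]esumZl; last 2 first.
- by rewrite lee_fin powR_ge0.
- by move=> k; rewrite lee_fin powR_ge0.
apply: le_esum => u /= un; rewrite -EFinM lee_fin -powRM ?norm_word_ge0//.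
rewrite ge0_ler_powR// ?nnegrE ?mulr_ge0 ?norm_word_ge0//.
by rewrite -un norm_word_perturb.
Qed.

End perturbation.

(** * The Hausdorff dimension in terms of the partition sums *)

Section dimension.
Context {R : realType} (tau : R[i]) (tauA : A0 tau).
Implicit Types (s t : R) (n : nat).

Lemma psum_finite_le (W : seq (seq (nat * nat))) n s :
  uniq W -> (forall w, w \in W -> size w = n) ->
  ((\sum_(w <- W) norm_word tau w `^ s)%:E <= psum tau n s)%E.
Proof.
move=> Wu Wn; apply: esum_ge; exists [set` W].
  by split; [exact: finite_seq | move=> w /=; exact: Wn].
by rewrite -fsbig_seq// sumEFin.
Qed.

(** The inequality holds for a finite subsum, and divided by 4^s this becomes a finite sum of
    exponentials in [s], which lies above its tangents. *)
Lemma psum_gt_right n s : ((4 `^ s)%:E < psum tau n s)%E ->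
  exists2 s', s < s' & ((4 `^ s')%:E < psum tau n s')%E.
Proof.
move=> /psum_gt_finite [W [Wu Wn Ws]].
pose q w := norm_word tau w / 4; pose A := \sum_(w <- W) q w `^ s.
pose B := \sum_(w <- W) q w `^ s * ln (q w).
have q0 w : 0 < q w by rewrite divr_gt0// norm_word_gt0.
have sumE x : \sum_(w <- W) norm_word tau w `^ x = 4 `^ x * \sum_(w <- W) q w `^ x.
  rewrite mulr_sumr; apply: eq_bigr => w _.
  by rewrite -powRM ?(ltW (q0 w))// /q mulrCA mulfV// mulr1.
have A1 : 1 < A.
  by move: Ws; rewrite sumE -[ltLHS]mulr1 ltr_pM2l// powR_gt0.
have B0 : 0 < 2 * (`|B| + 1) by rewrite mulr_gt0// ltr_wpDl.
pose d := (A - 1) / (2 * (`|B| + 1)).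
have d0 : 0 < d by rewrite divr_gt0// subr_gt0.
exists (s + d); first by rewrite ltrDl.
apply: lt_le_trans (psum_finite_le _ Wu Wn); rewrite lte_fin sumE.
rewrite -[ltLHS]mulr1 ltr_pM2l ?powR_gt0//.
apply: (@lt_le_trans _ _ (A + d * B)); last first.
  rewrite /A /B mulr_sumr -big_split/=; apply: ler_sum => w _.
  apply: le_trans (powR_tangent s (s + d) (q0 w)).
  by rewrite addrAC subrr add0r mulrDr mulr1 mulrCA.
have dB : d * (2 * (`|B| + 1)) = A - 1 by rewrite /d divfK ?gt_eqF.
have := ler_norm (- B); rewrite normrN; nra.
Qed.

Let measure_zero s := 0 <= s /\ hausdorff_measure s (limit_set tau) = 0%E.

Lemma hausdorff_dim_fin_num : hausdorff_dim (limit_set tau) \is a fin_num.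
Proof.
rewrite ge0_fin_numE; last first.
  by apply: le_ereal_inf_tmp => _ [s [s0 _] <-]; rewrite lee_fin.
apply: (@le_lt_trans _ _ 2%:E); last exact: ltry.
apply: ereal_inf_lbound; exists 2 => //; split => //.
exact: hausdorff_measure_null (psum1_two tauA).
Qed.

Lemma hE : (h tau)%:E = hausdorff_dim (limit_set tau).
Proof. by rewrite fineK// hausdorff_dim_fin_num. Qed.

Lemma h_le s : measure_zero s -> h tau <= s.
Proof. by move=> s0; rewrite -lee_fin hE; apply: ereal_inf_lbound; exists s. Qed.

Lemma h_lt s : h tau < s -> exists2 s', measure_zero s' & s' < s.
Proof.
rewrite -lte_fin hE => /ereal_inf_lt [_ [s' s'0 <-]]; rewrite lte_fin => ?.
by exists s'.
Qed.

Lemma lt_h n s : 0 <= s -> ((4 `^ s)%:E < psum tau n s)%E -> s < h tau.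
Proof.
move=> s0 /psum_gt_right [s1 ss1 p1]; rewrite ltNge; apply/negP => hs.
have [s' [s'0 s'm] s's1] := h_lt (le_lt_trans hs ss1).
have : ((4 `^ s')%:E < psum tau n s')%E.
  apply: lt_le_trans (psum_antitone n tauA (ltW s's1)); apply: le_lt_trans p1.
  by rewrite lee_fin ler_powR ?(ltW s's1)// ler1n.
by move=> /(hausdorff_measure_pos tauA s'0); rewrite s'm eqxx.
Qed.

(** The partition sum is finite at [s0] < [s]; by convexity it is still less than 1 slightly
    to the left of [s]. *)
Lemma h_lt_psum n s : (0 < n)%N -> 1 < s -> (psum tau n s < 1)%E -> h tau < s.
Proof.
move=> n0 s1 ps; pose s0 := (1 + s) / 2.
have s01 : 1 < s0 by rewrite /s0; lra.
have s0s : s0 < s by rewrite /s0; lra.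
have fin_p x : (psum tau n x < +oo)%E -> psum tau n x = (fine (psum tau n x))%:E.
  by move=> xoo; rewrite fineK// ge0_fin_numE ?psum_ge0.
have := fin_p _ (psum_lty n tauA s01); have := fin_p _ (psum_lty n tauA s1).
set a := fine (psum tau n s0); set b := fine (psum tau n s) => bE aE.
have b1 : b < 1 by rewrite -lte_fin -bE.
have a0 : 0 <= a by rewrite -lee_fin -aE psum_ge0.
have b0 : 0 <= b by rewrite -lee_fin -bE psum_ge0.
pose l := (1 - b) / (2 * (a + 1)).
have lE : l * (2 * (a + 1)) = 1 - b by rewrite /l divfK// gt_eqF// mulr_gt0// ltr_wpDl.
have l0 : 0 < l by rewrite divr_gt0 ?subr_gt0// mulr_gt0// ltr_wpDl.
have l1 : l <= 1 by nra.
apply: (@le_lt_trans _ _ (l * s0 + (1 - l) * s)); last by nra.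
have sl0 : 0 <= l * s0 + (1 - l) * s by nra.
apply: h_le; split => //; apply: (hausdorff_measure_null tauA sl0 n0).
apply: le_lt_trans (psum_convex _ _ _ tauA _) _; first by rewrite (ltW l0).
by rewrite aE bE -!EFinM -EFinD lte_fin; nra.
Qed.

Lemma h_gt1 : 1 < h tau.
Proof. by apply: (@lt_h 1%N) => //; rewrite psum1_infinite// ltry. Qed.

Lemma h_lt2 : h tau < 2.
Proof. by apply: (@h_lt_psum 1%N) => //; [lra | exact: psum1_two]. Qed.

Lemma h_ge0 : 0 <= h tau. Proof. by have := h_gt1; lra. Qed.

(** This bound and the next one hold at all levels, so that the pressure vanishes at [h]. *)
Lemma psum_h_le n : (psum tau n (h tau) <= (4 `^ h tau)%:E)%E.
Proof.
by rewrite leNgt; apply/negP => /(lt_h h_ge0); rewrite ltxx.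
Qed.

Lemma psum_h_ge n : (0 < n)%N -> (1 <= psum tau n (h tau))%E.
Proof.
by move=> n0; rewrite leNgt; apply/negP => /(h_lt_psum n0 h_gt1); rewrite ltxx.
Qed.

End dimension.

(** * The pressure function *)

Section pressure.
Context {R : realType}.

(** Both v (k n) - k v n and v (k n) - n v k are controlled, hence the
    differences of the quotients. *)
Lemma almost_additive_cvg (v : nat -> R) (C : R) :
  (forall n m, `|v (n + m)%N - v n - v m| <= C) -> cvgn (fun n => n%:R^-1 * v n).
Proof.
move=> vC; have C0 : 0 <= C by apply: le_trans (vC 0%N 0%N).
have vmul n k : `|v (k.+1 * n)%N - k.+1%:R * v n| <= k%:R * C.
  elim: k => [|k IH]; first by rewrite mul1n !mul1r subrr normr0 mul0r.
  have := lerD IH (vC n (k.+1 * n)%N); rewrite -mulSn => H.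
  apply: le_trans (le_trans _ H) _; last by rewrite -[k.+1 in leRHS]addn1 natrD mulrDl mul1r.
  rewrite addrC; apply: le_trans (ler_normD _ _); rewrite le_eqVlt; apply/orP; left; apply/eqP.
  by congr `|_|; rewrite -[k.+2]addn1 natrD; ring.
have vdiff n m : `|m.+1%:R^-1 * v m.+1 - n.+1%:R^-1 * v n.+1| <= (m.+1%:R^-1 + n.+1%:R^-1) * C.
  have := lerD (vmul n.+1 m) (vmul m.+1 n).
  rewrite [(n.+1 * m.+1)%N]mulnC.
  set N : R := n.+1%:R; set M : R := m.+1%:R; rewrite -[X in `|X| + _ <= _]opprB normrN.
  have N0 : 0 < N by rewrite ltr0n.
  have M0 : 0 < M by rewrite ltr0n.
  have nN : n%:R <= N by rewrite ler_nat.
  have mM : m%:R <= M by rewrite ler_nat.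
  move=> H.
  have -> : M^-1 * v m.+1 - N^-1 * v n.+1 = (N * v m.+1 - M * v n.+1) / (M * N).
    by field; rewrite !gt_eqF.
  have -> : (M^-1 + N^-1) * C = (M + N) * C / (M * N).
    by field; rewrite !gt_eqF.
  rewrite normrM [`|_^-1|]ger0_norm ?invr_ge0 ?mulr_ge0 ?(ltW M0) ?(ltW N0)//.
  rewrite ler_pM2r ?invr_gt0 ?mulr_gt0//.
  rewrite distrC; apply: (@le_trans _ _ (m%:R * C + n%:R * C)); last first.
    by rewrite -mulrDl ler_wpM2r// lerD.
  apply: le_trans H; apply: le_trans (ler_normD _ _).
  by rewrite le_eqVlt; apply/orP; left; apply/eqP; congr `|_|; ring.
have [|n|l lP] := @nested_limit R (fun n => n.+1%:R^-1 * v n.+1) (fun n => 2 * C * harmonic n).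
- move=> n m nm; apply: le_trans (vdiff n m) _; rewrite /harmonic/= mulrAC ler_wpM2r//.
  rewrite mulr_natl mulr2n lerD2r.
  by rewrite lef_pV2 ?posrE ?ltr0n// ler_nat.
- by rewrite mulr_ge0 ?mulr_ge0// harmonic_ge0.
apply/cvg_ex; exists l; rewrite -cvg_shiftS.
have : (fun n => 2 * C * (harmonic n : R)) @ \oo --> (0 : R).
  by rewrite -(mulr0 (2 * C)); apply: cvgM; [exact: cvg_cst | exact: cvg_harmonic].
move=> /cvgrPdist_le small; apply/cvgrPdist_le => e e0.
apply: filterS (small e e0) => n; rewrite sub0r normrN => Cn.
by rewrite distrC; apply: le_trans (lP n) (le_trans (ler_norm _) Cn).
Qed.

Lemma lim_inv_le (v : nat -> R) (l a c : R) :
  (fun n => n%:R^-1 * v n) @ \oo --> l ->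
  (forall n, (0 < n)%N -> v n <= a * n%:R + c) -> l <= a.
Proof.
move=> vl va; move: vl; rewrite -cvg_shiftS => vl.
have ul : (fun n => a + c * (harmonic n : R)) @ \oo --> a.
  rewrite -[X in _ --> X]addr0 -(mulr0 c); apply: cvgD; first exact: cvg_cst.
  by apply: cvgM; [exact: cvg_cst | exact: cvg_harmonic].
apply: ler_cvg_to vl ul _; apply: nearW => n.
rewrite ler_pdivrMl ?ltr0n//; apply: le_trans (va n.+1 _) _ => //.
by rewrite /harmonic/= mulrDr mulrCA mulfV ?pnatr_eq0// mulr1 mulrC.
Qed.

Context (tau : R[i]) (tauA : A0 tau).
Implicit Types t : R.

Lemma letter_inj : injective (letter tau).
Proof.
have [u0 v1] := tauA; have v0 : Im tau != 0 by rewrite gt_eqF//; lra.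
move=> [a b] [c d] H.
have := congr1 (@complex.Im R) H; rewrite !Im_letter /= => /(mulIf v0)/eqP.
rewrite eqr_nat eqSS => /eqP bd.
have := congr1 (@complex.Re R) H; rewrite !Re_letter /= bd => /addIr/eqP.
by rewrite eqr_nat eqSS => /eqP ->.
Qed.

Lemma psi_psum n t : psi tau n t = psum tau n t.
Proof.
rewrite /psi /psum.
pose e (u : seq (nat * nat)) : n.-tuple R[i] := [tuple nth 0 (map (letter tau) u) i | i < n].
have eE u : size u = n -> e u = map (letter tau) u :> seq R[i].
  move=> un; apply: (@eq_from_nth _ 0); first by rewrite size_tuple size_map.
  move=> i; rewrite size_tuple => ilt.
  by rewrite -[i in LHS]/(val (Ordinal ilt)) -tnth_nth tnth_mktuple.
rewrite (@reindex_esum _ _ _ [set u : seq (nat * nat) | size u = n] _ e); last first.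
  split.
  - move=> u /= un i; apply/alphabetP; exists (nth (0, 0)%N u i).
    by rewrite tnth_mktuple (nth_map (0, 0)%N) ?un.
  - move=> u v /set_mem /= un /set_mem /= vn /(congr1 (@tval _ _)).
    by rewrite !eE//; apply: inj_map; exact: letter_inj.
  - move=> w /= wA.
    have /choice[p pP] : forall i, exists p, tnth w i = letter tau p.
      by move=> i; apply/alphabetP.
    exists [seq p i | i <- enum 'I_n]; first by rewrite /= size_map size_enum_ord.
    apply: eq_from_tnth => i; rewrite tnth_mktuple pP -map_comp.
    by rewrite (nth_map i) ?size_enum_ord//= nth_ord_enum.
apply: eq_esum => u /= un; rewrite eE// deriv_normE ?poweR_EFin//.
exact: all_good.
Qed.

Definition log_psum t n : R := ln (fine (psum tau n t)).

Lemma fine_psum n t : 1 < t -> psum tau n t = (fine (psum tau n t))%:E.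
Proof. by move=> t1; rewrite fineK// ge0_fin_numE ?psum_ge0// psum_lty. Qed.

Lemma fine_psum_gt0 n t : 1 < t -> 0 < fine (psum tau n t).
Proof. by move=> t1; rewrite -lte_fin -fine_psum// psum_gt0. Qed.

(** Sub- and supermultiplicativity of the partition sums differ by the factor 4^t. *)
Lemma log_psum_cvg t : 1 < t -> cvgn (fun n => n%:R^-1 * log_psum t n).
Proof.
move=> t1; have t0 : 0 <= t by lra.
apply: (@almost_additive_cvg _ (t * ln 4)) => n m; rewrite /log_psum.
have := psum_add_le n m tauA t0; have := psum_add_ge n m tauA t0.
have pos k := fine_psum_gt0 k t1.
rewrite (fine_psum n t1) (fine_psum m t1) (fine_psum (n + m) t1) -!EFinM !lee_fin.
have p4 : 0 < 4 `^ t :> R by rewrite powR_gt0.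
rewrite -ler_ln ?posrE ?mulr_gt0 ?pos// !lnM ?posrE ?pos// ln_powR => h1.
rewrite -ler_ln ?posrE ?mulr_gt0 ?pos// !lnM ?posrE ?pos// => h2.
have l4 : 0 <= t * ln 4 by rewrite mulr_ge0// ln_ge0// ler1n.
by rewrite ler_norml; apply/andP; split; lra.
Qed.

Lemma pressureE t : 1 < t -> pressure tau t = (limn (fun n => n%:R^-1 * log_psum t n))%:E.
Proof.
move=> t1; rewrite -EFin_lim; last exact: log_psum_cvg.
congr (limn _); apply/funext => n /=.
by rewrite psi_psum (fine_psum n t1) lne_EFin ?fine_psum_gt0// EFinM.
Qed.

Lemma pressure_le1 t : 0 <= t -> t <= 1 -> pressure tau t = +oo%E.
Proof.
move=> t0 t1.
have p1 : psum tau 1 t = +oo%E.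
  by apply/eqP; rewrite -leye_eq -(psum1_infinite tauA); apply: psum_antitone.
have pn n : psum tau n.+1 t = +oo%E.
  have := psum_add_ge 1 n tauA t0; rewrite add1n p1 gt0_mulye ?psum_gt0//.
  rewrite leye_eq; apply: contraTeq => noo.
  have pf : psum tau n.+1 t \is a fin_num by rewrite ge0_fin_numE ?psum_ge0// ltey.
  by rewrite -ltey -(fineK pf) -EFinM ltry.
apply/cvg_lim => //; apply: cvg_near_cst; exists 1%N => // -[//|n] _.
by rewrite psi_psum pn/= gt0_muley// lte_fin invr_gt0 ltr0n.
Qed.

Lemma log_psum_h_le n : log_psum (h tau) n <= h tau * ln 4.
Proof.
rewrite /log_psum -ln_powR ler_ln ?posrE ?powR_gt0 ?fine_psum_gt0 ?h_gt1//.
by rewrite -lee_fin -fine_psum ?h_gt1// psum_h_le.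
Qed.

Lemma log_psum_h_ge n : (0 < n)%N -> 0 <= log_psum (h tau) n.
Proof.
move=> n0; rewrite /log_psum ln_ge0// -lee_fin -fine_psum ?h_gt1//.
exact: psum_h_ge.
Qed.

Lemma log_psum_shift s t n : 1 < s -> s <= t ->
  log_psum t n <= (t - s) * ln (2 / 3) * n%:R + log_psum s n.
Proof.
move=> s1 st; have t1 : 1 < t by lra.
have := psum_shift n tauA st; rewrite (fine_psum n s1) (fine_psum n t1) -EFinM lee_fin.
have q0 : 0 < 2 / 3 :> R by rewrite divr_gt0.
have c0 : 0 < ((2 / 3) ^+ n) `^ (t - s) :> R by rewrite powR_gt0// exprn_gt0.
have [ps pt] := (fine_psum_gt0 n s1, fine_psum_gt0 n t1) => le_st.
have : ln (fine (psum tau n t)) <=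
    ln (((2 / 3) ^+ n) `^ (t - s) * fine (psum tau n s)).
  by rewrite ler_ln ?posrE ?mulr_gt0.
by rewrite [ln (_ `^ _ * _)]lnM ?posrE// ln_powR lnXn// -[ln (2 / 3) *+ n]mulr_natr mulrA.
Qed.

Lemma ln23_lt0 : ln (2 / 3) < 0 :> R.
Proof. by rewrite ln_lt0// divr_gt0//= ltr_pdivrMr// mul1r ltr_nat. Qed.

Lemma pressure_h : pressure tau (h tau) = 0%E.
Proof.
have c := log_psum_cvg (h_gt1 tauA); rewrite pressureE ?h_gt1//; congr (_%:E).
apply/eqP; rewrite eq_le; apply/andP; split.
  apply: (lim_inv_le (c := h tau * ln 4) c) => n _.
  by rewrite mul0r add0r log_psum_h_le.
apply: limr_ge => //; apply: nearW => -[|n]; first by rewrite invr0 mul0r.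
by rewrite mulr_ge0// log_psum_h_ge.
Qed.

Lemma pressure_unique t : 0 <= t -> pressure tau t = 0%E -> t = h tau.
Proof.
move=> t0; have [t1|t1] := leP t 1; first by rewrite pressure_le1.
have c := log_psum_cvg t1; rewrite pressureE// => -[P0].
have h1 := h_gt1 tauA; have l23 := ln23_lt0.
have [th|ht|//] := ltgtP t (h tau); exfalso.
  have cN : (fun n => n%:R^-1 * - log_psum t n) @ \oo --> 0.
    rewrite -oppr0 -P0; under eq_fun do rewrite mulrN; exact: cvgN.
  have : 0 <= (h tau - t) * ln (2 / 3).
    apply: (lim_inv_le (c := 0) cN) => n n0.
    by have := log_psum_shift n t1 (ltW th); have := log_psum_h_ge n0; lra.
  by nra.
have : 0 <= (t - h tau) * ln (2 / 3).
  rewrite -P0; apply: (lim_inv_le (c := h tau * ln 4) c) => n _.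
  by have := log_psum_shift n h1 (ltW ht); have := log_psum_h_le n; lra.
by nra.
Qed.

End pressure.

(** * Variation of the dimension with the parameter *)

Section variation.
Context {R : realType}.
Implicit Types (tau : R[i]) (eps : R).

Lemma powR_expn (a x : R) n : 0 <= a -> (a ^+ n) `^ x = (a `^ x) ^+ n.
Proof.
move=> a0; rewrite -powR_mulrn// -powRrM mulrC powRrM powR_mulrn//.
exact: powR_ge0.
Qed.

(** At level n and exponent h tau + eps, the factor (1 + 8 eta)^(2 n t) lost by changing
    [tau], where t <= 3, competes with the factor (2/3)^(n eps) gained by increasing the
    exponent; the remaining factor 4^h is less than 16 at all levels. *)
Lemma h_perturb tau tau' eps : A0 tau -> A0 tau' -> 0 < eps <= 1 ->
  (1 + 8 * cmod (tau - tau')) ^+ 6 * (2 / 3) `^ eps < 1 -> h tau' < h tau + eps.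
Proof.
move=> tA tA' /andP[eps0 eps1]; set eta := cmod _; set c := _ * _ => c1.
have eta0 : 0 <= eta by exact: cmod_ge0.
have [h1 h2] := (h_gt1 tA, h_lt2 tA).
pose t := h tau + eps; have t1 : 1 < t by rewrite /t; lra.
have t0 : 0 <= t by lra.
have c0 : 0 <= c by rewrite mulr_ge0 ?powR_ge0// exprn_ge0// addr_ge0// mulr_ge0.
have [n] := @geometric_small R c (c * 16) 1 (introT andP (conj c0 c1)) ltr01.
rewrite mulrAC -exprS => cn; apply: (@h_lt_psum _ tau' tA' n.+1) => //.
apply: le_lt_trans (psum_perturb tA tA' n.+1 t0) _.
have shift : (psum tau n.+1 t <= ((((2 / 3) `^ eps) ^+ n.+1) * 16)%:E)%E.
  have := psum_shift n.+1 tA (_ : h tau <= t); rewrite {1}/t lerDl (ltW eps0) => /(_ isT).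
  rewrite /t addrAC subrr add0r => /le_trans; apply.
  have -> : ((2 / 3) ^+ n.+1) `^ eps = ((2 / 3) `^ eps) ^+ n.+1 :> R.
    by rewrite powR_expn// divr_ge0.
  rewrite EFinM lee_wpmul2l ?lee_fin ?exprn_ge0 ?powR_ge0//.
  apply: le_trans (psum_h_le tA _) _; rewrite lee_fin.
  have -> : 16 = 4 `^ 2 :> R by rewrite powR_mulrn// -natrX.
  by rewrite ler_powR ?ler1n// ltW.
apply: (@le_lt_trans _ _ (((1 + 8 * eta) ^+ 6) ^+ n.+1 * (((2 / 3) `^ eps) ^+ n.+1 * 16))%:E).
  rewrite [leRHS]EFinM; apply: lee_pmul => //; rewrite ?lee_fin ?powR_ge0 ?psum_ge0//.
  have e1 : 1 <= 1 + 8 * eta by rewrite lerDl mulr_ge0.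
  apply: (@le_trans _ _ ((((1 + 8 * eta) ^+ 2) ^+ n.+1) `^ 3)).
    by apply: ler_powR; [rewrite !exprn_ege1 | rewrite /t; lra].
  by rewrite powR_mulrn ?exprn_ge0 ?addr_ge0 ?mulr_ge0// exprAC -[(_ ^+ 2) ^+ 3]exprM.
by rewrite mulrA -exprMn lte_fin.
Qed.

Lemma h_continuous_at tau eps : A0 tau -> 0 < eps -> exists2 d : R, 0 < d &
  forall tau', A0 tau' -> cmod (tau - tau') < d -> `|h tau - h tau'| < eps.
Proof.
move=> tA eps0; pose e := Num.min eps 1.
have e0 : 0 < e by rewrite lt_min eps0 ltr01.
have e1 : e <= 1 by rewrite ge_min lexx orbT.
pose q : R := (3 / 2) `^ e.
have q1 : 1 < q `^ 6^-1.
  have : 1 `^ 6^-1 < q `^ (6^-1 : R); last by rewrite powR1.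
  rewrite gt0_ltr_powR ?invr_gt0 ?nnegrE ?powR_ge0//.
  have : 1 `^ e < q; last by rewrite powR1.
  by rewrite gt0_ltr_powR// ?nnegrE ?divr_ge0// ltr_pdivlMr// mul1r ltr_nat.
exists ((q `^ 6^-1 - 1) / 8); first by rewrite divr_gt0// subr_gt0.
move=> tau' tA' near_tau.
have small x : 0 <= x -> x < (q `^ 6^-1 - 1) / 8 -> (1 + 8 * x) ^+ 6 * (2 / 3) `^ e < 1.
  move=> x0 xq; have qq : (2 / 3) `^ e = q^-1.
    have q0 : q != 0 by rewrite gt_eqF// powR_gt0// divr_gt0.
    apply: (mulIf q0); rewrite mulVf// -powRM ?divr_ge0//.
    by rewrite -[3 / 2]invf_div mulfV ?powR1// mulf_neq0 ?invr_neq0.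
  rewrite qq ltr_pdivrMr ?powR_gt0 ?divr_gt0// mul1r.
  have <- : (q `^ 6^-1) ^+ 6 = q.
    by rewrite -powR_mulrn ?powR_ge0// -powRrM mulVf// powRr1 ?powR_ge0.
  by rewrite ltrXn2r ?nnegrE//; lra.
have H1 : h tau' < h tau + e.
  by apply: h_perturb => //; [rewrite e0 | exact: small (cmod_ge0 _) near_tau].
have H2 : h tau < h tau' + e.
  apply: h_perturb => //; first by rewrite e0.
  by rewrite cmod_distC; exact: small (cmod_ge0 _) near_tau.
have ee : e <= eps by rewrite ge_min lexx.
by rewrite ltr_norml; apply/andP; split; lra.
Qed.

Lemma h_continuous : {within (A0 : set R[i]), continuous (h : R[i] -> R)}.
Proof.
apply/subspace_continuousP => tau tA; apply/cvgrPdist_lt => eps eps0.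
have [d d0 dP] := h_continuous_at tA eps0.
rewrite near_withinE; apply/nbhs_normP; exists d%:C%C; first by rewrite /= ltcR.
by move=> tau' /=; rewrite normc_cmod ltcR => near_tau tA'; exact: dP.
Qed.

Lemma h_asymptotic eps : 0 < eps -> exists2 N : R, 0 < N &
  forall tau, A0 tau -> N <= cmod tau -> `|h tau - 1| < eps.
Proof.
move=> eps0; pose C := (1 + eps^-1) ^+ 2.
have C0 : 0 <= C by exact: sqr_ge0.
exists (C + 1) => [|tau tA CT]; first by lra.
have h1 := h_gt1 tA; rewrite ger0_norm; last by lra.
rewrite ltrBlDl; have t1 : 1 < 1 + eps by lra.
apply: (@h_lt_psum _ _ tA 1%N) => //.
apply: le_lt_trans (psum1_product tA t1) _.
have T1 : 1 <= cmod tau by lra.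
have TT : cmod tau <= cmod tau `^ (1 + eps).
  by rewrite -[leLHS]powRr1 ?cmod_ge0// ler_powR//; lra.
rewrite lte_fin addrAC subrr add0r -/C mulrC ltr_pdivrMr ?mul1r; first by lra.
by apply: lt_le_trans TT; lra.
Qed.

End variation.

Theorem theorem1p2 (R : realType) :
  [/\ (forall tau : R[i], A0 tau ->
         hausdorff_dim (limit_set tau) \is a fin_num),
      {within (A0 : set R[i]), continuous (h : R[i] -> R)},
      (forall tau : R[i], A0 tau ->
         [/\ 0 <= h tau,
             pressure tau (h tau) = 0%E,
             (forall t : R, 0 <= t -> pressure tau t = 0%E -> t = h tau),
             1 < h tau & h tau < 2]) &
      (forall eps : R, 0 < eps -> exists2 N : R, 0 < N &
         forall tau : R[i], A0 tau -> N <= cmod tau -> `|h tau - 1| < eps)].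
Proof.
split.
- exact: hausdorff_dim_fin_num.
- exact: h_continuous.
- move=> tau tA; split.
  + exact: h_ge0.
  + exact: pressure_h.
  + exact: pressure_unique.
  + exact: h_gt1.
  + exact: h_lt2.
- exact: h_asymptotic.
Qed.
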